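(* Let $R$ be a commutative ring with a derivation $D$, with ring of constants $R^D$. Let $A$ be a differential Azumaya $R$-algebra. Then $A$ has a faithful differential module $P$, finitely generated and projective over $R$, with an $R$-basis of constants (and hence free over $R$), if and only if $A$ is isomorphic, as a differential algebra, to $R \otimes_{R^D} A_0$ for some Azumaya $R^D$-algebra $A_0$.
   Context: A differential Azumaya $R$-algebra is an Azumaya $R$-algebra $A$ with a derivation $D_A$ extending the derivation $D$ of $R$. Isomorphisms of differential algebras are $R$-algebra isomorphisms commuting with the derivations. A differential $A$-module is an $A$-module $P$ with an additive endomorphism $D_P$ satisfying $D_P(ap)=D_A(a)p+aD_P(p)$ for all $a\in A$, $p\in P$; an element $p\in P$ is constant if $D_P(p)=0$. $R^D=\{r\in R:D(r)=0\}$. The derivation on $R\otimes_{R^D}A_0$ is $D(r\otimes a)=D(r)\otimes a$. *)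

(* Defs.v *)
From HB Require Import structures.
From mathcomp Require Import all_boot all_order all_algebra generic_quotient.
From mathcomp Require Import boolp.

Set Implicit Arguments.
Unset Strict Implicit.
Unset Printing Implicit Defensive.

Import GRing.Theory.
Local Open Scope ring_scope.
Local Open Scope quotient_scope.

Section Modules.
Variables (R : pzRingType) (M : lmodType R).

Definition generates (n : nat) (b : 'I_n -> M) : Prop :=
  forall x, exists c : 'I_n -> R, x = \sum_(i < n) c i *: b i.

Definition finitely_generated : Prop :=
  exists (n : nat) (b : 'I_n -> M), generates b.

Definition is_basis (n : nat) (b : 'I_n -> M) : Prop :=
  forall x, exists! c : {ffun 'I_n -> R}, x = \sum_(i < n) c i *: b i.

Definition projective : Prop :=
  forall (U V : lmodType R) (g : {linear U -> V}) (f : {linear M -> V}),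
    (forall v, exists u, g u = v) -> exists h : {linear M -> U}, g \o h =1 f.

Definition faithful : Prop := forall r : R, (forall x : M, r *: x = 0) -> r = 0.

End Modules.

Arguments finitely_generated {R} M.
Arguments projective {R} M.
Arguments faithful {R} M.

(* An A-module regarded as an R-module through R -> A. *)
Definition restrict (R : pzRingType) (A : lalgType R) (P : lmodType A) : Type := P.

Section Restrict.
Variables (R : pzRingType) (A : lalgType R) (P : lmodType A).
Local Notation Q := (restrict P).

HB.instance Definition _ := GRing.Zmodule.on Q.

Definition restrict_scale (r : R) (x : Q) : Q := (r%:A : A) *: (x : P).

Fact restrict_scaleA r s x :
  restrict_scale r (restrict_scale s x) = restrict_scale (r * s) x.
Proof. by rewrite /restrict_scale scalerA mulr_algl scalerA. Qed.

Fact restrict_scale1 : left_id 1 restrict_scale.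
Proof. by move=> x; rewrite /restrict_scale !scale1r. Qed.

Fact restrict_scaleDr : right_distributive restrict_scale +%R.
Proof. by move=> r x y; rewrite /restrict_scale scalerDr. Qed.

Fact restrict_scaleDl x : {morph restrict_scale^~ x : r s / r + s}.
Proof. by move=> r s; rewrite /restrict_scale !scalerDl. Qed.

HB.instance Definition _ := GRing.Zmodule_isLmodule.Build R Q
  restrict_scaleA restrict_scale1 restrict_scaleDr restrict_scaleDl.

End Restrict.

(* The tensor product M (x)_S N over a commutative ring: finite formal sums of
   pairs, modulo the congruence generated by the bilinearity relations. *)
Section Tensor.
Variables (S : comPzRingType) (M N : lmodType S).

Inductive tens_eq : seq (M * N) -> seq (M * N) -> Prop :=
| tens_eq_refl s : tens_eq s s
| tens_eq_sym s t : tens_eq s t -> tens_eq t s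
| tens_eq_trans s t u : tens_eq s t -> tens_eq t u -> tens_eq s u
| tens_eq_cat s s' t t' : tens_eq s s' -> tens_eq t t' ->
    tens_eq (s ++ t) (s' ++ t')
| tens_eq_catC s t : tens_eq (s ++ t) (t ++ s)
| tens_eq_0 y : tens_eq [:: (0, y)] [::]
| tens_eq_Dl x x' y : tens_eq [:: (x + x', y)] [:: (x, y); (x', y)]
| tens_eq_Dr x y y' : tens_eq [:: (x, y + y')] [:: (x, y); (x, y')]
| tens_eq_Z a x y : tens_eq [:: (a *: x, y)] [:: (x, a *: y)].

Definition tens_eqb : rel (seq (M * N)) := fun s t => `[< tens_eq s t >].

Fact tens_eqb_refl : reflexive tens_eqb.
Proof. by move=> s; apply/asboolP; exact: tens_eq_refl. Qed.

Fact tens_eqb_sym : symmetric tens_eqb.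
Proof. by move=> s t; apply/asboolP/asboolP; exact: tens_eq_sym. Qed.

Fact tens_eqb_trans : transitive tens_eqb.
Proof.
move=> t s u /asboolP st /asboolP tu; apply/asboolP; exact: tens_eq_trans st tu.
Qed.

Canonical tens_equiv :=
  EquivRel tens_eqb tens_eqb_refl tens_eqb_sym tens_eqb_trans.

Definition tens : Type := {eq_quot tens_equiv}.
HB.instance Definition _ := Choice.on tens.
HB.instance Definition _ := EqQuotient.on tens.

Lemma tens_pi_eq s t : tens_eq s t -> \pi_tens s = \pi_tens t.
Proof. by move=> st; apply/(eqmodP tens_equiv)/asboolP. Qed.

Lemma tens_pi_inj s t : \pi_tens s = \pi_tens t -> tens_eq s t.
Proof. by move=> /(eqmodP tens_equiv)/asboolP. Qed.

Lemma tens_eq_repr s : tens_eq (repr (\pi_tens s)) s.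
Proof. by apply: tens_pi_inj; rewrite reprK. Qed.

Definition tens_add (t u : tens) : tens := \pi_tens (repr t ++ repr u).
Definition tens_zero : tens := \pi_tens [::].
Definition tens_opp (t : tens) : tens :=
  \pi_tens [seq (- p.1, p.2) | p <- repr t].

Lemma tens_add_pi s t : tens_add (\pi_tens s) (\pi_tens t) = \pi_tens (s ++ t).
Proof. by apply: tens_pi_eq; apply: tens_eq_cat; exact: tens_eq_repr. Qed.

Fact tens_addA : associative tens_add.
Proof.
move=> t u v; rewrite -[t]reprK -[u]reprK -[v]reprK.
by rewrite !tens_add_pi !reprK catA.
Qed.

Fact tens_addC : commutative tens_add.
Proof. by move=> t u; apply: tens_pi_eq; exact: tens_eq_catC. Qed.

Fact tens_add0 : left_id tens_zero tens_add.
Proof. by move=> t; rewrite -[t]reprK tens_add_pi. Qed.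

Fact tens_addN : left_inverse tens_zero tens_opp tens_add.
Proof.
move=> t; rewrite -{2}[t]reprK tens_add_pi /tens_zero; apply: tens_pi_eq.
elim: (repr t) => [|[x y] s IHs] /=; first exact: tens_eq_refl.
set s' := map _ s in IHs *.
have E1 : tens_eq ((- x, y) :: s' ++ (x, y) :: s)
                  ([:: (- x, y)] ++ [:: (x, y)] ++ (s ++ s')).
  apply: (tens_eq_cat (s := [:: _]) (s' := [:: _])); first exact: tens_eq_refl.
  exact: (tens_eq_catC s' ((x, y) :: s)).
apply: tens_eq_trans E1 _.
apply: (@tens_eq_cat [:: (- x, y); (x, y)] [::] (s ++ s') [::]).
  apply: tens_eq_trans (tens_eq_0 y).
  by apply: tens_eq_sym; have := tens_eq_Dl (- x) x y; rewrite addNr.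
exact: tens_eq_trans (tens_eq_catC _ _) IHs.
Qed.

HB.instance Definition _ :=
  GRing.isZmodule.Build tens tens_addA tens_addC tens_add0 tens_addN.

Definition tensor (x : M) (y : N) : tens := \pi_tens [:: (x, y)].

Lemma tensorDl y : {morph tensor^~ y : x x' / x + x'}.
Proof.
move=> x x'; rewrite [RHS]tens_add_pi; apply: tens_pi_eq; exact: tens_eq_Dl.
Qed.

Lemma tensorDr x : {morph tensor x : y y' / y + y'}.
Proof.
move=> y y'; rewrite [RHS]tens_add_pi; apply: tens_pi_eq; exact: tens_eq_Dr.
Qed.

Lemma tensorZ a x y : tensor (a *: x) y = tensor x (a *: y).
Proof. by apply: tens_pi_eq; exact: tens_eq_Z. Qed.

Lemma tens_piE s : \pi_tens s = \sum_(p <- s) tensor p.1 p.2.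
Proof.
elim: s => [|[x y] s IHs]; first by rewrite big_nil.
by rewrite big_cons -IHs /= [RHS]tens_add_pi.
Qed.

Lemma tens_ind (Q : tens -> Prop) :
  Q 0 -> (forall x y, Q (tensor x y)) -> (forall t u, Q t -> Q u -> Q (t + u)) ->
  forall t, Q t.
Proof.
move=> Q0 Qxy QD t; rewrite -[t]reprK tens_piE.
by elim/big_ind: _ => // -[x y] _; exact: Qxy.
Qed.

Definition balanced (V : zmodType) (f : M -> N -> V) : Prop :=
  [/\ forall y, {morph f^~ y : x x' / x + x'},
      forall x, {morph f x : y y' / y + y'}
    & forall a x y, f (a *: x) y = f x (a *: y)].

(* For balanced f, the additive map with x (x) y |-> f x y (tens_liftE). *)
Definition tens_lift (V : zmodType) (f : M -> N -> V) (t : tens) : V :=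
  \sum_(p <- repr t) f p.1 p.2.

Section Lift.
Variables (V : zmodType) (f : M -> N -> V).
Hypothesis fB : balanced f.

Lemma tens_lift_pi s : tens_lift f (\pi_tens s) = \sum_(p <- s) f p.1 p.2.
Proof.
case: fB => fDl fDr fZ; rewrite /tens_lift.
move: (repr _) (tens_eq_repr s) => s'; elim=> {s s'} //=.
- by move=> s t u _ -> _ ->.
- by move=> s s' t t' _ IHs _ IHt; rewrite !big_cat /= IHs IHt.
- by move=> s t; rewrite !big_cat /= addrC.
- move=> y; rewrite big_seq1 big_nil /=.
  by apply: (@addrI _ (f 0 y)); rewrite -fDl !addr0.
- by move=> x x' y; rewrite !(big_cons, big_nil) /= !addr0 fDl.
- by move=> x y y'; rewrite !(big_cons, big_nil) /= !addr0 fDr.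
- by move=> a x y; rewrite !big_seq1 /= fZ.
Qed.

Lemma tens_liftE x y : tens_lift f (tensor x y) = f x y.
Proof. by rewrite tens_lift_pi big_seq1. Qed.

Lemma tens_liftD : {morph tens_lift f : t u / t + u}.
Proof.
move=> t u; rewrite -[t]reprK -[u]reprK [X in tens_lift f X]tens_add_pi.
by rewrite !tens_lift_pi big_cat.
Qed.

Lemma tens_lift0 : tens_lift f 0 = 0.
Proof. by apply: (@addrI _ (tens_lift f 0)); rewrite -tens_liftD !addr0. Qed.

End Lift.

Lemma tens_lift_add (V : zmodType) (f g : M -> N -> V) t :
  tens_lift (fun x y => f x y + g x y) t = tens_lift f t + tens_lift g t.
Proof. exact: big_split. Qed.

Lemma eq_tens_lift (V : zmodType) (f g : M -> N -> V) t :
  (forall x y, f x y = g x y) -> tens_lift f t = tens_lift g t.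
Proof. by move=> fg; apply: eq_bigr => p _; exact: fg. Qed.

End Tensor.

Section TensorAlgebra.
Variables (S : comPzRingType) (M N : algType S).
Local Notation T := (tens M N).

Definition tens_one : T := tensor 1 1.

(* (x (x) y) (x' (x) y') = x x' (x) y y' *)
Definition tens_mul (t u : T) : T :=
  tens_lift (fun x y => tens_lift (fun x' y' => tensor (x * x') (y * y')) u) t.

Lemma tens_mul_bal1 (x : M) (y : N) :
  balanced (fun (x' : M) (y' : N) => tensor (x * x') (y * y') : T).
Proof.
split=> [y' a b|x' a b|a x' y'] /=.
- by rewrite mulrDr tensorDl.
- by rewrite mulrDr tensorDr.
- by rewrite -!scalerAr tensorZ.
Qed.

Lemma tens_mul_bal2 (u : T) :
  balanced (fun (x : M) (y : N) =>
    tens_lift (fun x' y' => tensor (x * x') (y * y')) u : T).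
Proof.
split=> [y a b|x a b|a x y] /=.
- rewrite -tens_lift_add; apply: eq_tens_lift => x' y'.
  by rewrite mulrDl tensorDl.
- rewrite -tens_lift_add; apply: eq_tens_lift => x' y'.
  by rewrite mulrDl tensorDr.
- by apply: eq_tens_lift => x' y'; rewrite -!scalerAl tensorZ.
Qed.

Lemma tens_mulE x y x' y' :
  tens_mul (tensor x y) (tensor x' y') = tensor (x * x') (y * y').
Proof.
rewrite /tens_mul (tens_liftE (tens_mul_bal2 _)).
by rewrite (tens_liftE (tens_mul_bal1 _ _)).
Qed.

Fact tens_mulDl : left_distributive tens_mul +%R.
Proof. by move=> t u v; rewrite /tens_mul (tens_liftD (tens_mul_bal2 _)). Qed.

Fact tens_mulDr : right_distributive tens_mul +%R.
Proof.
move=> t u v; rewrite /tens_mul -tens_lift_add; apply: eq_tens_lift => x y.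
by rewrite (tens_liftD (tens_mul_bal1 _ _)).
Qed.

Let mul0 t : tens_mul 0 t = 0.
Proof. by apply: (@addrI _ (tens_mul 0 t)); rewrite -tens_mulDl !addr0. Qed.

Let mulr0 t : tens_mul t 0 = 0.
Proof. by apply: (@addrI _ (tens_mul t 0)); rewrite -tens_mulDr !addr0. Qed.

Fact tens_mulA : associative tens_mul.
Proof.
move=> t u v; elim/tens_ind: t => [|x y|t t' IH IH']; first by rewrite !mul0.
  elim/tens_ind: u => [|x' y'|u u' IH IH']; first by rewrite !(mul0, mulr0).
    elim/tens_ind: v => [|x2 y2|v v' IH IH']; first by rewrite !mulr0.
      by rewrite !tens_mulE !mulrA.
    by rewrite !tens_mulDr IH IH'.
  by rewrite !(tens_mulDr, tens_mulDl) IH IH'.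
by rewrite !tens_mulDl IH IH'.
Qed.

Fact tens_mul1 : left_id tens_one tens_mul.
Proof.
elim/tens_ind => [|x y|t u IHt IHu]; first exact: mulr0.
  by rewrite tens_mulE !mul1r.
by rewrite tens_mulDr IHt IHu.
Qed.

Fact tens_mulr1 : right_id tens_one tens_mul.
Proof.
elim/tens_ind => [|x y|t u IHt IHu]; first exact: mul0.
  by rewrite tens_mulE !mulr1.
by rewrite tens_mulDl IHt IHu.
Qed.

HB.instance Definition _ := GRing.Zmodule_isPzRing.Build T
  tens_mulA tens_mul1 tens_mulr1 tens_mulDl tens_mulDr.

Lemma tensorM (x x' : M) (y y' : N) :
  (tensor x y : T) * tensor x' y' = tensor (x * x') (y * y').
Proof. exact: tens_mulE. Qed.

End TensorAlgebra.

Section Azumaya.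
Variables (R : comNzRingType) (A : algType R).

(* The canonical map A (x)_R A^op -> End_R(A), a (x) b |-> (x |-> a x b). The
   opposite multiplication on the second factor plays no role in bijectivity. *)
Definition sandwich (t : tens A A) (x : A) : A :=
  tens_lift (fun a b => a * x * b) t.

Lemma sandwich_bal (x : A) : balanced (fun a b : A => a * x * b).
Proof.
split=> [b a a'|a b b'|r a b] /=; first by rewrite !mulrDl.
  by rewrite mulrDr.
by rewrite -!scalerAl -scalerAr.
Qed.

Lemma sandwichE a b x : sandwich (tensor a b) x = a * x * b.
Proof. exact: tens_liftE (sandwich_bal x) a b. Qed.

Lemma sandwichD t u x : sandwich (t + u) x = sandwich t x + sandwich u x.
Proof. exact: tens_liftD (sandwich_bal x) t u. Qed.

Lemma sandwich_linear t : linear (sandwich t).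
Proof.
move=> r x y; rewrite /sandwich /tens_lift scaler_sumr -big_split /=.
by apply: eq_bigr => p _; rewrite mulrDr mulrDl -scalerAr -scalerAl.
Qed.

Definition azumaya : Prop :=
  [/\ finitely_generated A, projective A, faithful A
    & forall f : {linear A -> A}, exists! t : tens A A, sandwich t =1 f].

End Azumaya.

Arguments azumaya {R} A.

Record derivation (R : pzRingType) := Derivation {
  der_fun :> R -> R;
  derD : {morph der_fun : x y / x + y};
  derM : forall x y, der_fun (x * y) = der_fun x * y + x * der_fun y
}.

Section DerivationTheory.
Variables (R : pzRingType) (D : derivation R).

Lemma der0 : D 0 = 0.
Proof. by apply: (@addrI _ (D 0)); rewrite -derD !addr0. Qed.

Lemma derN x : D (- x) = - D x.
Proof. by apply: (@addrI _ (D x)); rewrite -derD !subrr der0. Qed.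

Lemma der1 : D 1 = 0.
Proof.
by apply: (@addrI _ (D 1)); rewrite addr0 -{3}[1]mulr1 derM mulr1 mul1r.
Qed.

End DerivationTheory.

Section Constants.
Variables (R : comNzRingType) (D : derivation R).

Definition constant : {pred R} := fun x => D x == 0.

Fact constant_subring : subring_closed constant.
Proof.
split=> [|x y|x y]; rewrite !unfold_in.
- by rewrite der1.
- by move=> /eqP Dx /eqP Dy; rewrite derD derN Dx Dy subr0.
- by move=> /eqP Dx /eqP Dy; rewrite derM Dx Dy mul0r mulr0 addr0.
Qed.

HB.instance Definition _ := GRing.isSubringClosed.Build R constant
  constant_subring.

(* R^D *)
Record constants := Constants { cval : R; _ : cval \in constant }.

HB.instance Definition _ := [isSub for cval].
HB.instance Definition _ := [Choice of constants by <:].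
HB.instance Definition _ := [SubChoice_isSubComNzRing of constants by <:].

Lemma der_cval (s : constants) : D (cval s) = 0.
Proof. by case: s => x xD; apply/eqP. Qed.

End Constants.

(* R regarded as an R^D-algebra *)
Definition over_constants (R : comNzRingType) (D : derivation R) : Type := R.

Section OverConstants.
Variables (R : comNzRingType) (D : derivation R).
Local Notation RD := (over_constants D).
Local Notation constants := (constants D).

HB.instance Definition _ := GRing.ComNzRing.on RD.

Definition over_constants_scale (s : constants) (x : RD) : RD :=
  (cval s * x : R).

Fact over_constants_scaleA s t x :
  over_constants_scale s (over_constants_scale t x) =
  over_constants_scale (s * t) x.
Proof. by rewrite /over_constants_scale mulrA. Qed.

Fact over_constants_scale1 : left_id 1 over_constants_scale.
Proof. by move=> x; exact: mul1r. Qed.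

Fact over_constants_scaleDr : right_distributive over_constants_scale +%R.
Proof. by move=> s x y; exact: mulrDr. Qed.

Fact over_constants_scaleDl x :
  {morph over_constants_scale^~ x : s t / s + t}.
Proof. by move=> s t; exact: mulrDl. Qed.

HB.instance Definition _ := GRing.Zmodule_isLmodule.Build constants RD
  over_constants_scaleA over_constants_scale1
  over_constants_scaleDr over_constants_scaleDl.

Fact over_constants_scaleAl (s : constants) (x y : RD) :
  s *: (x * y) = s *: x * y.
Proof. exact: (mulrA (cval s)). Qed.

HB.instance Definition _ :=
  GRing.Lmodule_isLalgebra.Build constants RD over_constants_scaleAl.
HB.instance Definition _ := GRing.Lalgebra_isComAlgebra.Build constants RD.

End OverConstants.

(* R (x)_{R^D} A0, as a differential R-algebra *)
Definition base_change (R : comNzRingType) (D : derivation R)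
  (A0 : algType (constants D)) : Type := tens (over_constants D) A0.

Section BaseChange.
Variables (R : comNzRingType) (D : derivation R) (A0 : algType (constants D)).
Local Notation RD := (over_constants D).
Local Notation T := (base_change A0).

HB.instance Definition _ := GRing.PzRing.on T.

Definition base_change_scale (r : R) (t : T) : T :=
  (tensor (r : RD) 1 : tens RD A0) * t.

Lemma base_change_scaleE (r : R) (x : RD) (a : A0) :
  base_change_scale r (tensor x a) = tensor ((r : RD) * x) a.
Proof. by rewrite /base_change_scale [LHS]tensorM mul1r. Qed.

Fact base_change_scaleA r s t :
  base_change_scale r (base_change_scale s t) = base_change_scale (r * s) t.
Proof. by rewrite /base_change_scale mulrA tensorM mulr1. Qed.

Fact base_change_scale1 : left_id 1 base_change_scale.
Proof. by move=> t; exact: (mul1r (t : tens RD A0)). Qed.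

Fact base_change_scaleDr : right_distributive base_change_scale +%R.
Proof. by move=> r t u; exact: mulrDr. Qed.

Fact base_change_scaleDl t : {morph base_change_scale^~ t : r s / r + s}.
Proof. by move=> r s; rewrite /base_change_scale tensorDl mulrDl. Qed.

HB.instance Definition _ := GRing.Zmodule_isLmodule.Build R T
  base_change_scaleA base_change_scale1
  base_change_scaleDr base_change_scaleDl.

(* T satisfies the R-algebra laws, but is no algType instance: MathComp algebras
   are nonzero, which R (x)_{R^D} A0 need not be for an arbitrary A0. *)
Lemma base_change_scaleAl (r : R) (t u : T) : r *: (t * u) = (r *: t) * u.
Proof. exact: (mulrA (tensor (r : RD) 1 : tens RD A0)). Qed.

Lemma base_change_scaleAr (r : R) (t u : T) : r *: (t * u) = t * (r *: u).
Proof.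
pose c : tens RD A0 := tensor (r : RD) 1.
have cC : c * t = t * c.
  elim/tens_ind: t => [|x a|t t' IH IH']; first by rewrite mulr0 mul0r.
    by rewrite /c !tensorM mulr1 mul1r mulrC.
  by rewrite mulrDr mulrDl IH IH'.
rewrite -[LHS]/(c * (t * u)) -[RHS]/((t : tens RD A0) * (c * u)).
by rewrite !mulrA cC.
Qed.

(* D (r (x) a) = D r (x) a *)
Definition base_change_der_fun (t : T) : T :=
  tens_lift (fun (x : RD) (a : A0) => tensor (D x : RD) a) t.

Lemma base_change_der_bal :
  balanced (fun (x : RD) (a : A0) => tensor (D x : RD) a).
Proof.
split=> [a x x'|x a a'|s x a] /=.
- by rewrite derD tensorDl.
- by rewrite tensorDr.
- by rewrite -tensorZ; congr tensor; rewrite derM der_cval mul0r add0r.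
Qed.

Lemma base_change_derE (x : RD) (a : A0) :
  base_change_der_fun (tensor x a) = tensor (D x : RD) a.
Proof. exact: tens_liftE base_change_der_bal x a. Qed.

Fact base_change_derD : {morph base_change_der_fun : t u / t + u}.
Proof. exact: tens_liftD base_change_der_bal. Qed.

Fact base_change_derM t u : base_change_der_fun (t * u) =
  base_change_der_fun t * u + t * base_change_der_fun u.
Proof.
have d0 : base_change_der_fun 0 = 0 by exact: tens_lift0 base_change_der_bal.
elim/tens_ind: t => [|x a|t t' IH IH'].
- by rewrite mul0r d0 !mul0r addr0.
- elim/tens_ind: u => [|y b|u u' IH IH'].
  + by rewrite mulr0 d0 !mulr0 addr0.
  + rewrite !base_change_derE [X in base_change_der_fun X]tensorM.
    rewrite base_change_derE derM tensorDl.
    by congr (_ + _); rewrite [RHS]tensorM.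
  + by rewrite mulrDr !base_change_derD IH IH' !mulrDr addrACA.
- by rewrite mulrDl !base_change_derD IH IH' !mulrDl addrACA.
Qed.

Definition base_change_der : derivation T :=
  Derivation base_change_derD base_change_derM.

Lemma base_change_der_extends (r : R) :
  base_change_der (r *: (1 : T) : T) = D r *: (1 : T).
Proof.
have E (x : R) : x *: (1 : T) = tensor (x : RD) 1.
  by rewrite -[LHS]/(base_change_scale x (tensor 1 1)) base_change_scaleE mulr1.
by rewrite !E; exact: base_change_derE.
Qed.

End BaseChange.

Definition extends_derivation (R : comNzRingType) (D : derivation R)
  (A : algType R) (DA : derivation A) : Prop :=
  forall r : R, DA r%:A = (D r)%:A.

Definition differential_module (A : pzRingType) (DA : derivation A)
  (P : lmodType A) (DP : {additive P -> P}) : Prop :=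
  forall (a : A) (p : P), DP (a *: p) = DA a *: p + a *: DP p.

(* Main.v *)
Require Import Defs.
From HB Require Import structures.
From mathcomp Require Import all_boot all_order all_algebra.
From mathcomp Require Import generic_quotient perm boolp ring zify.

Set Implicit Arguments.
Unset Strict Implicit.
Unset Printing Implicit Defensive.

Import GRing.Theory.
Local Open Scope ring_scope.
Local Open Scope quotient_scope.

(** Both conditions are equivalent to A being, as a differential module, a direct
    summand of a free module with a basis of constants; in other words, A has a
    dual basis made of constant elements and constant forms. Descent along such a
    dual basis makes R (x) A^D -> A an isomorphism, and A^D is Azumaya because the
    element of A (x) A inducing a constant endomorphism is constant by uniqueness.

    Given P with a basis of constants, A is a differential subalgebra of M_n(R),
    which is A (x) C for the centraliser C of A. The flip tensor of M_n(R) is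
    constant, and contracting it yields a projection of M_n(R) onto A that
    commutes with the derivations.

    Conversely A^D is a faithful finitely generated projective R^D-module, so by a
    theorem of Bass A^D (x) Q is free and nonzero for some Q; take
    P = R (x) A^D (x) Q. To find Q, cover the spectrum by the loci where minors of
    an idempotent matrix are invertible. The matrix factorizations attached to the
    minors tensor up to an identity \prod_i (x - r_i) = 0 between classes of
    projective modules, from which an effective inverse of x, up to a positive
    integer, is extracted. *)

(** * Projective modules as idempotent matrices *)

Section FunctionMatrices.
Variable S : comNzRingType.
Implicit Types I J L M : finType.

Definition fmul I J L (A : I -> J -> S) (B : J -> L -> S) : I -> L -> S :=
  fun i l => \sum_j A i j * B j l.

Definition fone I : I -> I -> S := fun i j => (i == j)%:R.

Definition fscale I J (c : S) (A : I -> J -> S) : I -> J -> S :=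
  fun i j => c * A i j.

Definition fadd I J (A B : I -> J -> S) : I -> J -> S :=
  fun i j => A i j + B i j.

Definition fzero I J : I -> J -> S := fun _ _ => 0.

Definition ftens I J I' J' (A : I -> J -> S) (B : I' -> J' -> S) :
    I * I' -> J * J' -> S :=
  fun x y => A x.1 y.1 * B x.2 y.2.

Definition fblock I I' J J' (A : I -> J -> S) (B : I -> J' -> S)
    (C : I' -> J -> S) (E : I' -> J' -> S) : I + I' -> J + J' -> S :=
  fun x y => match x, y with
  | inl i, inl j => A i j
  | inl i, inr j => B i j
  | inr i, inl j => C i j
  | inr i, inr j => E i j
  end.

Lemma fmx_eq I J (A B : I -> J -> S) : (forall i j, A i j = B i j) -> A = B.
Proof. by move=> AB; apply/funext => i; apply/funext => j. Qed.

Lemma fmulA I J L M (A : I -> J -> S) (B : J -> L -> S) (C : L -> M -> S) :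
  fmul A (fmul B C) = fmul (fmul A B) C.
Proof.
apply: fmx_eq => i m; rewrite /fmul.
under eq_bigr do rewrite mulr_sumr.
rewrite exchange_big; apply: eq_bigr => l _.
by rewrite mulr_suml; apply: eq_bigr => j _; rewrite mulrA.
Qed.

Lemma fmul1l I J (A : I -> J -> S) : fmul (@fone I) A = A.
Proof.
apply: fmx_eq => i j; rewrite /fmul /fone (bigD1 i) //= eqxx mul1r big1 ?addr0//.
by move=> k; rewrite eq_sym => /negPf ->; rewrite mul0r.
Qed.

Lemma fmul1r I J (A : I -> J -> S) : fmul A (@fone J) = A.
Proof.
apply: fmx_eq => i j; rewrite /fmul /fone (bigD1 j) //= eqxx mulr1 big1 ?addr0//.
by move=> k /negPf ->; rewrite mulr0.
Qed.

Lemma fmulZl I J L c (A : I -> J -> S) (B : J -> L -> S) :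
  fmul (fscale c A) B = fscale c (fmul A B).
Proof.
apply: fmx_eq => i l; rewrite /fmul /fscale mulr_sumr.
by apply: eq_bigr => j _; rewrite mulrA.
Qed.

Lemma fmulZr I J L c (A : I -> J -> S) (B : J -> L -> S) :
  fmul A (fscale c B) = fscale c (fmul A B).
Proof.
apply: fmx_eq => i l; rewrite /fmul /fscale mulr_sumr.
by apply: eq_bigr => j _; rewrite mulrCA.
Qed.

Lemma fmul0l I J L (B : J -> L -> S) : fmul (@fzero I J) B = @fzero I L.
Proof. by apply: fmx_eq => i l; apply: big1 => j _; rewrite mul0r. Qed.

Lemma fmul0r I J L (A : I -> J -> S) : fmul A (@fzero J L) = @fzero I L.
Proof. by apply: fmx_eq => i l; apply: big1 => j _; rewrite mulr0. Qed.

Lemma fmulDl I J L (A B : I -> J -> S) (C : J -> L -> S) :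
  fmul (fadd A B) C = fadd (fmul A C) (fmul B C).
Proof.
apply: fmx_eq => i l; rewrite /fmul /fadd -big_split.
by apply: eq_bigr => j _; rewrite mulrDl.
Qed.

Lemma fmulDr I J L (A : I -> J -> S) (B C : J -> L -> S) :
  fmul A (fadd B C) = fadd (fmul A B) (fmul A C).
Proof.
apply: fmx_eq => i l; rewrite /fmul /fadd -big_split.
by apply: eq_bigr => j _; rewrite mulrDr.
Qed.

Lemma fmul_tens I J L I' J' L' (A : I -> J -> S) (B : I' -> J' -> S)
    (C : J -> L -> S) (E : J' -> L' -> S) :
  fmul (ftens A B) (ftens C E) = ftens (fmul A C) (fmul B E).
Proof.
apply: fmx_eq => -[i i'] [l l']; rewrite /fmul /ftens /= mulr_suml.
under [RHS]eq_bigr do rewrite mulr_sumr.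
by rewrite pair_bigA; apply: eq_bigr => -[j j'] _; rewrite /= mulrACA.
Qed.

Lemma fmul_block I1 I2 J1 J2 L1 L2
    (A : I1 -> J1 -> S) (B : I1 -> J2 -> S)
    (C : I2 -> J1 -> S) (E : I2 -> J2 -> S)
    (A' : J1 -> L1 -> S) (B' : J1 -> L2 -> S)
    (C' : J2 -> L1 -> S) (E' : J2 -> L2 -> S) :
  fmul (fblock A B C E) (fblock A' B' C' E') =
  fblock (fadd (fmul A A') (fmul B C')) (fadd (fmul A B') (fmul B E'))
         (fadd (fmul C A') (fmul E C')) (fadd (fmul C B') (fmul E E')).
Proof. by apply: fmx_eq => -[i|i] [l|l]; rewrite /fmul big_sumType. Qed.

Lemma fscale_tens I J I' J' c c' (A : I -> J -> S) (B : I' -> J' -> S) :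
  ftens (fscale c A) (fscale c' B) = fscale (c * c') (ftens A B).
Proof. by apply: fmx_eq => i j; rewrite /ftens /fscale mulrACA. Qed.

Lemma fscale1 I J (A : I -> J -> S) : fscale 1 A = A.
Proof. by apply: fmx_eq => i j; rewrite /fscale mul1r. Qed.

Lemma fscaleA I J c c' (A : I -> J -> S) :
  fscale c (fscale c' A) = fscale (c * c') A.
Proof. by apply: fmx_eq => i j; rewrite /fscale mulrA. Qed.

End FunctionMatrices.

Arguments fone {S} I.
Arguments fzero {S} I J.

(* Index types closed under sums and products; codes are used instead of
   arbitrary finite types because the latter are too large to be quotiented. *)
Inductive shape := Ord of nat | Sum of shape & shape | Prod of shape & shape.

Fixpoint cells (c : shape) : finType :=
  match c with
  | Ord n => 'I_n
  | Sum c1 c2 => (cells c1 + cells c2)%type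
  | Prod c1 c2 => (cells c1 * cells c2)%type
  end.

Section Idempotents.
Variable S : comNzRingType.

(* An idempotent matrix stands for its image, a finitely generated projective
   module. *)
Record idem := Idem {
  ishape : shape;
  imx :> cells ishape -> cells ishape -> S;
  imxK : fmul imx imx = imx
}.

Definition idx (X : idem) : finType := cells (ishape X).

Implicit Types X Y Z : idem.

(* A matrix factorization of [f]: maps X -> Y -> X whose two composites are
   multiplication by [f]; for [f = 1] it is an isomorphism. *)
Inductive mf (f : S) X Y : Prop :=
  MF (a : idx X -> idx Y -> S) (b : idx Y -> idx X -> S) of
    fmul X a = a & fmul a Y = a & fmul Y b = b & fmul b X = b
    & fmul a b = fscale f X & fmul b a = fscale f Y.

Lemma imul_subproof X Y : fmul (ftens X Y) (ftens X Y) = ftens X Y.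
Proof. by rewrite fmul_tens !imxK. Qed.
Definition imul X Y :=
  @Idem (Prod (ishape X) (ishape Y)) _ (imul_subproof X Y).

Lemma iadd_subproof X Y :
  let B := fblock X (fzero _ _) (fzero _ _) Y in fmul B B = B.
Proof.
rewrite /= fmul_block !imxK !fmul0l !fmul0r.
by apply: fmx_eq => -[i|i] [j|j]; rewrite /= /fadd /fzero ?addr0 ?add0r.
Qed.
Definition iadd X Y :=
  @Idem (Sum (ishape X) (ishape Y)) _ (iadd_subproof X Y).

Definition ifree (c : shape) := @Idem c _ (fmul1l (@fone S (cells c))).

Lemma mf_refl X : mf 1 X X.
Proof. by exists X X; rewrite ?imxK ?fscale1. Qed.

Lemma mf_sym f X Y : mf f X Y -> mf f Y X.
Proof. by case=> a b *; exists b a. Qed.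

Lemma mf_zero X Y : mf 0 X Y.
Proof.
exists (fzero _ _) (fzero _ _); rewrite ?fmul0l ?fmul0r //;
by apply: fmx_eq => i j; rewrite /fscale mul0r.
Qed.

Lemma mf_scale g f X Y : mf f X Y -> mf (g * f) X Y.
Proof.
case=> a b h1 h2 h3 h4 h5 h6; exists (fscale g a) b => //;
by rewrite ?fmulZl ?fmulZr ?h1 ?h2 ?h5 ?h6 ?fscaleA.
Qed.

Lemma mf_comp f g X Y Z : mf f X Y -> mf g Y Z -> mf (f * g) X Z.
Proof.
case=> a b h1 h2 h3 h4 h5 h6 [a' b' k1 k2 k3 k4 k5 k6].
exists (fmul a a') (fmul b' b).
- by rewrite fmulA h1.
- by rewrite -fmulA k2.
- by rewrite fmulA k3.
- by rewrite -fmulA h4.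
- by rewrite -fmulA (fmulA a') k5 fmulZl fmulZr h3 h5 fscaleA mulrC.
- by rewrite -fmulA (fmulA b) h6 fmulZl fmulZr k1 k6 fscaleA.
Qed.

Lemma mf_add f X Y X' Y' :
  mf f X Y -> mf f X' Y' -> mf f (iadd X X') (iadd Y Y').
Proof.
case=> a b h1 h2 h3 h4 h5 h6 [a' b' k1 k2 k3 k4 k5 k6].
exists (fblock a (fzero _ _) (fzero _ _) a')
       (fblock b (fzero _ _) (fzero _ _) b') => /=;
rewrite fmul_block ?fmul0l ?fmul0r ?h1 ?h2 ?h3 ?h4 ?h5 ?h6;
rewrite ?k1 ?k2 ?k3 ?k4 ?k5 ?k6;
apply: fmx_eq => -[i|i] [j|j];
by rewrite /= /fadd /fzero /fscale /fblock ?addr0 ?add0r ?mulr0.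
Qed.

Lemma mf_mul f g X Y X' Y' :
  mf f X Y -> mf g X' Y' -> mf (f * g) (imul X X') (imul Y Y').
Proof.
case=> a b h1 h2 h3 h4 h5 h6 [a' b' k1 k2 k3 k4 k5 k6].
by exists (ftens a a') (ftens b b'); rewrite /= fmul_tens
  ?h1 ?h2 ?h3 ?h4 ?h5 ?h6 ?k1 ?k2 ?k3 ?k4 ?k5 ?k6 ?fscale_tens.
Qed.

(* Tensoring adds the scalars, so that factorizations of comaximal scalars
   combine into a factorization of 1, an isomorphism. *)
Lemma mf_tensor f g X Y X' Y' : mf f X Y -> mf g X' Y' ->
  mf (f + g) (iadd (imul X X') (imul Y Y')) (iadd (imul X Y') (imul Y X')).
Proof.
case=> a b h1 h2 h3 h4 h5 h6 [a' b' k1 k2 k3 k4 k5 k6].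
exists (fblock (ftens X a') (ftens a X')
               (ftens b Y') (fscale (-1) (ftens Y b')))
       (fblock (ftens X b') (ftens a Y')
               (ftens b X') (fscale (-1) (ftens Y a'))) => /=;
rewrite fmul_block ?fmul0l ?fmul0r ?fmulZl ?fmulZr ?fmul_tens ?imxK
  ?h1 ?h2 ?h3 ?h4 ?h5 ?h6 ?k1 ?k2 ?k3 ?k4 ?k5 ?k6;
apply: fmx_eq => -[i|i] [j|j];
rewrite /= /fadd /fzero /fscale /ftens /=; ring.
Qed.

(** The two maps are [Y] with its rows or its columns reindexed by [s]. Most semiring laws for
    classes below come from such bijections of index sets. *)
Lemma mf_relabel X Y (s : idx X -> idx Y) :
  bijective s -> (forall i j, X i j = Y (s i) (s j)) -> mf 1 X Y.
Proof.
move=> sB XY.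
have re F : \sum_(j : idx Y) F j = \sum_(i : idx X) F (s i) :> S.
  by apply: reindex; exact: onW_bij.
have YK i j : \sum_k Y i k * Y k j = Y i j.
  by rewrite -[RHS](congr1 (fun A => A i j) (imxK Y)).
exists (fun i j => Y (s i) j) (fun j i => Y j (s i)); rewrite ?fscale1;
apply: fmx_eq => i j; rewrite /fmul ?XY -?YK //.
- by rewrite re; apply: eq_bigr => k _; rewrite XY.
- by rewrite re; apply: eq_bigr => k _; rewrite XY.
Qed.

End Idempotents.

(** * The semiring of isomorphism classes of projective modules *)

Section ProjectiveClasses.
Variable S : comNzRingType.

HB.instance Definition _ := gen_eqMixin (idem S).
HB.instance Definition _ := gen_choiceMixin (idem S).

Implicit Types X Y Z : idem S.

Definition isob : rel (idem S) := fun X Y => `[< mf 1 X Y >].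

Fact isob_refl : reflexive isob.
Proof. by move=> X; apply/asboolP; exact: mf_refl. Qed.

Fact isob_sym : symmetric isob.
Proof. by move=> X Y; apply/asboolP/asboolP; exact: mf_sym. Qed.

Fact isob_trans : transitive isob.
Proof.
move=> Y X Z /asboolP XY /asboolP YZ; apply/asboolP.
by rewrite -[1]mulr1; exact: mf_comp YZ.
Qed.

Canonical iso_equiv := EquivRel isob isob_refl isob_sym isob_trans.

Definition pclass : Type := {eq_quot iso_equiv}.
HB.instance Definition _ := Choice.on pclass.
HB.instance Definition _ := EqQuotient.on pclass.

Definition cls X : pclass := \pi_pclass X.

Lemma cls_eq X Y : mf 1 X Y -> cls X = cls Y.
Proof. by move=> XY; apply/(eqmodP iso_equiv)/asboolP. Qed.

Lemma cls_inj X Y : cls X = cls Y -> mf 1 X Y.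
Proof. by move=> /(eqmodP iso_equiv)/asboolP. Qed.

Lemma mf_repr X : mf 1 (repr (cls X)) X.
Proof. by apply: cls_inj; rewrite /cls reprK. Qed.

Lemma cls_repr (x : pclass) : exists X, x = cls X.
Proof. by exists (repr x); rewrite /cls reprK. Qed.

Definition cadd (x y : pclass) : pclass := cls (iadd (repr x) (repr y)).
Definition cmul (x y : pclass) : pclass := cls (imul (repr x) (repr y)).

Lemma caddE X Y : cadd (cls X) (cls Y) = cls (iadd X Y).
Proof. by apply: cls_eq; apply: mf_add; exact: mf_repr. Qed.

Lemma cmulE X Y : cmul (cls X) (cls Y) = cls (imul X Y).
Proof. by apply: cls_eq; rewrite -[1]mulr1; apply: mf_mul; exact: mf_repr. Qed.

Fact caddA : associative cadd.
Proof.
move=> x y z; have [X ->] := cls_repr x; have [Y ->] := cls_repr y.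
have [Z ->] := cls_repr z; rewrite !caddE; apply: cls_eq.
pose s (u : idx X + (idx Y + idx Z)) : idx X + idx Y + idx Z :=
  match u with inl i => inl (inl i) | inr (inl i) => inl (inr i)
             | inr (inr i) => inr i end.
pose s' (u : idx X + idx Y + idx Z) : idx X + (idx Y + idx Z) :=
  match u with inl (inl i) => inl i | inl (inr i) => inr (inl i)
             | inr i => inr (inr i) end.
apply: (@mf_relabel _ (iadd X (iadd Y Z)) (iadd (iadd X Y) Z) s).
  by exists s' => [[|[]]|[[]|]].
by move=> [i|[i|i]] [j|[j|j]].
Qed.

Fact caddC : commutative cadd.
Proof.
move=> x y; have [X ->] := cls_repr x; have [Y ->] := cls_repr y.
rewrite !caddE; apply: cls_eq.
pose s (I J : finType) (u : I + J) : J + I :=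
  match u with inl i => inr i | inr i => inl i end.
apply: (@mf_relabel _ (iadd X Y) (iadd Y X) (s _ _)).
  by exists (s _ _) => -[].
by move=> [i|i] [j|j].
Qed.

Fact cadd0 : left_id (cls (ifree S (Ord 0))) cadd.
Proof.
move=> x; have [X ->] := cls_repr x; rewrite !caddE; apply: cls_eq.
pose s (u : 'I_0 + idx X) : idx X :=
  match u with inl i => False_rect _ (notF (ltn_ord i)) | inr i => i end.
apply: (@mf_relabel _ (iadd (ifree S (Ord 0)) X) X s).
  by exists inr => // -[[]|].
by move=> [[]|i] [[]|j].
Qed.

HB.instance Definition _ := GRing.isNmodule.Build pclass caddA caddC cadd0.

Fact cmulA : associative cmul.
Proof.
move=> x y z; have [X ->] := cls_repr x; have [Y ->] := cls_repr y.
have [Z ->] := cls_repr z; rewrite !cmulE; apply: cls_eq.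
pose s (u : idx X * (idx Y * idx Z)) : idx X * idx Y * idx Z :=
  (u.1, u.2.1, u.2.2).
pose s' (u : idx X * idx Y * idx Z) : idx X * (idx Y * idx Z) :=
  (u.1.1, (u.1.2, u.2)).
apply: (@mf_relabel _ (imul X (imul Y Z)) (imul (imul X Y) Z) s).
  by exists s' => [[? []]|[[]]].
by move=> i j; exact: mulrA.
Qed.

Fact cmulC : commutative cmul.
Proof.
move=> x y; have [X ->] := cls_repr x; have [Y ->] := cls_repr y.
rewrite !cmulE; apply: cls_eq.
pose s (I J : finType) (u : I * J) : J * I := (u.2, u.1).
apply: (@mf_relabel _ (imul X Y) (imul Y X) (s _ _)).
  by exists (s _ _) => -[].
by move=> i j; exact: mulrC.
Qed.

Fact cmul1 : left_id (cls (ifree S (Ord 1))) cmul.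
Proof.
move=> x; have [X ->] := cls_repr x; rewrite !cmulE; apply: cls_eq.
apply: (@mf_relabel _ (imul (ifree S (Ord 1)) X) X snd).
  by exists (pair ord0) => // -[i k]; rewrite (ord1 i).
by move=> [i k] [j l]; rewrite /= /ftens /fone (ord1 i) (ord1 j) eqxx mul1r.
Qed.

Fact cmulDl : left_distributive cmul +%R.
Proof.
move=> x y z; have [X ->] := cls_repr x; have [Y ->] := cls_repr y.
have [Z ->] := cls_repr z.
rewrite -[LHS]/(cmul (cadd _ _) _) -[RHS]/(cadd (cmul _ _) (cmul _ _)).
rewrite !(cmulE, caddE); apply: cls_eq.
pose s (u : (idx X + idx Y) * idx Z) : idx X * idx Z + idx Y * idx Z :=
  match u.1 with inl i => inl (i, u.2) | inr i => inr (i, u.2) end.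
pose s' (u : idx X * idx Z + idx Y * idx Z) : (idx X + idx Y) * idx Z :=
  match u with inl v => (inl v.1, v.2) | inr v => (inr v.1, v.2) end.
apply: (@mf_relabel _ (imul (iadd X Y) Z) (iadd (imul X Z) (imul Y Z)) s).
  by exists s' => [[[]]|[[]|[]]].
by move=> [[i|i] i'] [[j|j] j']; rewrite /= /ftens //= /fzero mul0r.
Qed.

Fact cmul0 : left_zero 0 cmul.
Proof.
move=> x; have [X ->] := cls_repr x.
rewrite -[0]/(cls (ifree S (Ord 0))) cmulE; apply: cls_eq.
apply: (@mf_relabel _ (imul (ifree S (Ord 0)) X) (ifree S (Ord 0)) fst).
  by exists (fun i : 'I_0 => False_rect _ (notF (ltn_ord i))) => [[[]]|[]].
by move=> [[]].
Qed.

HB.instance Definition _ := GRing.Nmodule_isComPzSemiRing.Build pclass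
  cmulA cmulC cmul1 cmulDl cmul0.

Lemma clsD X Y : cls (iadd X Y) = cls X + cls Y.
Proof. by rewrite -caddE. Qed.

Lemma clsM X Y : cls (imul X Y) = cls X * cls Y.
Proof. by rewrite -cmulE. Qed.

Lemma cls_ifree_ord n : cls (ifree S (Ord n)) = n%:R.
Proof.
elim: n => // n IHn.
rewrite -addn1 natrD addrC -IHn -[1%:R]/(cls (ifree S (Ord 1))) -clsD addn1.
pose s (i : 'I_1 + 'I_n) : 'I_n.+1 :=
  match i with inl _ => ord0 | inr j => lift ord0 j end.
pose s' (i : 'I_n.+1) : 'I_1 + 'I_n :=
  match unlift ord0 i with None => inl ord0 | Some j => inr j end.
apply/esym/cls_eq/(@mf_relabel _
  (iadd (ifree S (Ord 1)) (ifree S (Ord n))) (ifree S (Ord n.+1)) s).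
  exists s' => [[i|j]|i]; rewrite /s' /s ?unlift_none ?liftK ?(ord1 i) //.
  by case: unliftP => [j|] ->.
by move=> [i|i] [j|j]; rewrite /= /fone /fzero ?eqxx ?(ord1 i) ?(ord1 j).
Qed.

Lemma cls_ifree c : cls (ifree S c) = #|cells c|%:R.
Proof.
rewrite -cls_ifree_ord.
apply/cls_eq/(@mf_relabel _ (ifree S c) (ifree S (Ord #|cells c|)) enum_rank).
  exact: enum_rank_bij.
by move=> i j; rewrite /= /fone (inj_eq enum_rank_inj).
Qed.

Definition mfc f (x y : pclass) := mf f (repr x) (repr y).

(** Changing representatives composes with isomorphisms, which multiplies the scalar by 1. *)
Lemma mfcE f X Y : mfc f (cls X) (cls Y) <-> mf f X Y.
Proof.
have XX := mf_repr X; have YY := mf_repr Y.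
split=> H; rewrite -[f]mul1r -[1 * f]mulr1.
  exact: mf_comp (mf_comp (mf_sym XX) H) YY.
exact: mf_comp (mf_comp XX H) (mf_sym YY).
Qed.

Lemma mfc1 x y : mfc 1 x y -> x = y.
Proof. by move=> /cls_eq; rewrite /cls !reprK. Qed.

Lemma mfc_mul f g x y x' y' :
  mfc f x y -> mfc g x' y' -> mfc (f * g) (x * x') (y * y').
Proof.
have [X ->] := cls_repr x; have [Y ->] := cls_repr y.
have [X' ->] := cls_repr x'; have [Y' ->] := cls_repr y'.
by rewrite -!clsM => /mfcE XY /mfcE XY'; apply/mfcE/mf_mul.
Qed.

Lemma mfc_tensor f g x y x' y' : mfc f x y -> mfc g x' y' ->
  mfc (f + g) (x * x' + y * y') (x * y' + y * x').
Proof.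
have [X ->] := cls_repr x; have [Y ->] := cls_repr y.
have [X' ->] := cls_repr x'; have [Y' ->] := cls_repr y'.
by rewrite -!clsM -!clsD => /mfcE XY /mfcE XY'; apply/mfcE/mf_tensor.
Qed.

Lemma mfcX f x y m : mfc f x y -> mfc (f ^+ m) (x ^+ m) (y ^+ m).
Proof.
move=> xy; elim: m => [|m IHm]; first by rewrite !expr0; exact: mf_refl.
by rewrite !exprS; exact: mfc_mul.
Qed.

Lemma icompl_subproof X :
  let C := fadd (fone _) (fscale (-1) X) in fmul C C = C.
Proof.
rewrite /= fmulDl !fmulDr !fmulZl !fmulZr !fmul1l fmul1r imxK.
by apply: fmx_eq => i j; rewrite /fadd /fscale; ring.
Qed.
Definition icompl X := Idem (icompl_subproof X).

(** The row block (X, 1 - X) and the corresponding column block are inverse isomorphisms between the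
    free module and the sum of the images. *)
Lemma cls_compl X : cls X + cls (icompl X) = #|idx X|%:R.
Proof.
rewrite -cls_ifree -clsD; apply/esym/cls_eq.
have XK i j : \sum_k X i k * X k j = X i j.
  by rewrite -[RHS](congr1 (fun A => A i j) (imxK X)).
have CK i j : \sum_k icompl X i k * icompl X k j = icompl X i j.
  by rewrite -[RHS](congr1 (fun A => A i j) (imxK (icompl X))).
have XC i j : \sum_k X i k * icompl X k j = 0.
  rewrite -[LHS]/(fmul X (fadd (fone _) (fscale (-1) X)) i j).
  by rewrite fmulDr fmulZr fmul1r imxK /fadd /fscale; ring.
have CX i j : \sum_k icompl X i k * X k j = 0.
  rewrite -[LHS]/(fmul (fadd (fone _) (fscale (-1) X)) X i j).
  by rewrite fmulDl fmulZl fmul1l imxK /fadd /fscale; ring.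
pose a (i : idx X) (j : idx X + idx X) : S :=
  match j with inl k => X i k | inr k => icompl X i k end.
pose b (j : idx X + idx X) (i : idx X) : S :=
  match j with inl k => X k i | inr k => icompl X k i end.
apply: (@MF _ 1 (ifree S (ishape X)) (iadd X (icompl X)) a b);
  rewrite ?fmul1l ?fmul1r ?fscale1 //; apply: fmx_eq.
- move=> i [j|j]; rewrite /fmul big_sumType /= ?XK ?CK /fzero.
    by rewrite [X in _ + X]big1 ?addr0 // => k _; rewrite mulr0.
  by rewrite [X in X + _]big1 ?add0r // => k _; rewrite mulr0.
- move=> [j|j] i; rewrite /fmul big_sumType /= ?XK ?CK /fzero.
    by rewrite [X in _ + X]big1 ?addr0 // => k _; rewrite mul0r.
  by rewrite [X in X + _]big1 ?add0r // => k _; rewrite mul0r.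
- move=> i j; rewrite /fmul big_sumType /= XK CK /= /fadd /fscale; ring.
- by move=> [i|i] [j|j]; rewrite /fmul /= ?XK ?CK ?XC ?CX.
Qed.

(** Since [u v = 1], the matrix [v u] is a rank one idempotent that splits off a free summand; the
    remaining summand is the image of [X - v u]. *)
Lemma cls_unimodular X (u v : idx X -> S) :
  (forall j, \sum_i u i * X i j = u j) -> (forall i, \sum_j X i j * v j = v i) ->
  \sum_i u i * v i = 1 -> exists y, cls X = 1 + y.
Proof.
move=> uX Xv uv.
have XK i j : \sum_k X i k * X k j = X i j.
  by rewrite -[RHS](congr1 (fun A => A i j) (imxK X)).
pose Y0 (i j : idx X) : S := X i j - v i * u j.
have uY j : \sum_i u i * Y0 i j = 0.
  under eq_bigr do rewrite mulrBr mulrA.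
  by rewrite sumrB uX -mulr_suml uv mul1r subrr.
have Yv i : \sum_j Y0 i j * v j = 0.
  under eq_bigr do rewrite mulrBl -mulrA.
  by rewrite sumrB Xv -mulr_sumr uv mulr1 subrr.
have XY i j : \sum_k X i k * Y0 k j = Y0 i j.
  under eq_bigr do rewrite mulrBr mulrA.
  by rewrite sumrB XK -mulr_suml Xv.
have YX i j : \sum_k Y0 i k * X k j = Y0 i j.
  under eq_bigr do rewrite mulrBl -mulrA.
  by rewrite sumrB XK -mulr_sumr uX.
have YY i j : \sum_k Y0 i k * Y0 k j = Y0 i j.
  under eq_bigr do rewrite mulrBr mulrA.
  by rewrite sumrB YX -mulr_suml Yv mul0r subr0.
have Y0K : fmul Y0 Y0 = Y0 by exact: fmx_eq.
pose Y := @Idem S (ishape X) Y0 Y0K.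
exists (cls Y); rewrite -[1]/(cls (ifree S (Ord 1))) -clsD; apply: cls_eq.
pose a (i : idx X) (j : 'I_1 + idx X) : S :=
  match j with inl _ => v i | inr k => Y0 i k end.
pose b (j : 'I_1 + idx X) (i : idx X) : S :=
  match j with inl _ => u i | inr k => Y0 k i end.
apply: (@MF _ 1 X (iadd (ifree S (Ord 1)) Y) a b);
  rewrite ?fscale1 //; apply: fmx_eq.
- by move=> i [k|k]; rewrite /fmul /= ?Xv ?XY.
- move=> i [k|k]; rewrite /fmul big_sumType /= ?YY /fzero big_ord1.
    by rewrite big1 => [|l _]; rewrite ?mulr0 // (ord1 k) /fone eqxx mulr1 addr0.
  by rewrite mulr0 add0r.
- move=> [k|k] i; rewrite /fmul big_sumType /= ?YY /fzero big_ord1.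
    by rewrite big1 => [|l _]; rewrite ?mul0r // (ord1 k) /fone eqxx mul1r addr0.
  by rewrite mul0r add0r.
- by move=> [k|k] i; rewrite /fmul /= ?uX ?YX.
- by move=> i j; rewrite /fmul big_sumType /= YY big_ord1 /Y0 addrC subrK.
- move=> [i|i] [j|j]; rewrite /fmul /= ?uY ?Yv ?YY //.
  by rewrite uv (ord1 i) (ord1 j) /fone eqxx.
Qed.

End ProjectiveClasses.

(** * Free tensor multiples of faithful projective modules *)

Section SemiringInverse.
Variables (K : comPzSemiRingType) (y : K) (B : nat).

(* The two sides of the expansion of [\prod_(c <- s) (y - c)]. *)
Fixpoint alt_prod (s : seq nat) : K * K :=
  if s is c :: s' then
    let: (p, m) := alt_prod s' in (p * y + m * c%:R, p * c%:R + m * y)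
  else (1, 0).

(* With [g = \prod_(c <- s) (Y - c)], these are [g(B)] and then the coefficients
   of the quotient [(g(B) - g(Y)) / (B - Y)]. *)
Fixpoint div_coef (s : seq nat) (i : nat) : nat :=
  if s is c :: s' then
    if i is j.+1 then (div_coef s' j - c * div_coef s' i)%N
    else ((B - c) * div_coef s' 0)%N
  else (i == 0).

Definition div_poly (s : seq nat) : K :=
  \sum_(i < size s) (div_coef s i.+1)%:R * y ^+ i.

Lemma div_coef_large s i : (size s < i)%N -> div_coef s i = 0%N.
Proof.
elim: s i => [|c s IHs] [|i] //= lt_si.
by rewrite !IHs ?muln0 // ltnW.
Qed.

(** Consecutive coefficients drop by a factor of at least [B - size s * t], which exceeds [t]. Hence
    the truncated subtractions in [div_coef] are exact. *)
Lemma div_coef_ratio s t : all (fun c => c <= t)%N s ->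
  ((size s).+1 * t < B)%N ->
  (0 < div_coef s 0)%N /\
  forall i, ((B - size s * t) * div_coef s i.+1 <= div_coef s i)%N.
Proof.
elim: s => [|c s IHs] /=; first by split=> // i; rewrite muln0.
move=> /andP[le_ct les] ltB; have [|pos ratio] := IHs les; first by nia.
split=> [|[|i]] /=; first by rewrite muln_gt0 pos andbT subn_gt0; nia.
  have := ratio 0%N; nia.
have := ratio i; have := ratio i.+1; nia.
Qed.

(** With q and q' the quotients for [s] and [c :: s], this is q' = g(B) + (y - c) q, with the
    negative term moved to the other side. *)
Lemma div_polyS c s t : all (fun d => d <= t)%N (c :: s) ->
  ((size s).+2 * t < B)%N ->
  div_poly (c :: s) + c%:R * div_poly s
    = y * div_poly s + (div_coef s 0)%:R.
Proof.
move=> /= /andP[le_ct les] ltB.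
have [|_ ratio] := div_coef_ratio les; first by nia.
have le_c i : (c * div_coef s i.+1 <= div_coef s i)%N by have := ratio i; nia.
have -> : c%:R * div_poly s =
    \sum_(i < (size s).+1) (c * div_coef s i.+1)%:R * y ^+ i.
  rewrite big_ord_recr /= div_coef_large // muln0 mul0r addr0 mulr_sumr.
  by apply: eq_bigr => i _; rewrite natrM mulrA.
rewrite /div_poly /= -big_split /=.
under eq_bigr => i _ do rewrite -mulrDl -natrD subnK //.
rewrite big_ord_recl expr0 mulr1 addrC mulr_sumr; congr (_ + _).
by apply: eq_bigr => i _; rewrite lift0 exprS mulrCA.
Qed.

(* [(B - y) * div_poly s = g(B) - g(y)], stably. *)
Lemma div_polyP s t : all (fun c => c <= t)%N s -> ((size s).+1 * t < B)%N ->
  exists z, B%:R * div_poly s + (alt_prod s).1 + z =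
    y * div_poly s + (div_coef s 0)%:R + (alt_prod s).2 + z.
Proof.
elim: s => [|c s IHs] les ltB.
  by exists 0; rewrite /div_poly big_ord0 !mulr0 /= !addr0.
have [||z IH] := IHs; first by case/andP: les.
  by move: ltB => /=; nia.
have E := div_polyS les ltB; set w' := div_poly (c :: s) in E *.
move: E IH => /=; case: (alt_prod s) => p m /=.
move: (div_poly s) => w E IH.
have cB : (c <= B)%N by case/andP: les => /= le_ct _; move: ltB => /=; nia.
have Ea : ((B - c) * div_coef s 0)%:R + c%:R * (div_coef s 0)%:R
          = B%:R * (div_coef s 0)%:R :> K.
  by rewrite -!natrM -natrD -mulnDl subnK.
move: Ea E IH; move: (div_coef s 0)%:R ((B - c) * _)%:R => a a' Ea E IH.
move: B%:R c%:R Ea E IH => b d Ea E IH.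
(* The induction hypothesis is needed times y and, with a minus sign, times d. Instead of
   subtracting, d (y w + a + m + z) is added to both sides; the term y z serves the multiple by
   y. *)
exists (y * d * w + d * a + m * d + d * z + y * z).
transitivity (b * w' + (p * y + m * d) + y * z +
              d * (y * w + a + m + z)); first by ring.
rewrite -IH.
transitivity (b * (w' + d * w) + p * y + m * d + y * z + d * p + d * z).
  by ring.
rewrite E.
transitivity (y * (b * w + p + z) + b * a + m * d + d * p + d * z); first by ring.
rewrite IH -Ea.
transitivity (y * (y * w + a) + (a' + d * a) + y * (m + z) + m * d + d * p + d * z).
  by ring.
by rewrite -E; ring.
Qed.

End SemiringInverse.

Section Cancellation.
Variable K : comPzSemiRingType.

(* The free summand of [h x] absorbs the stabilising term [c]. *)
Lemma stably_free_multiple (x x' : K) (n c h : nat) :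
  (0 < n)%N -> (0 < h)%N -> x + c%:R = n%:R + c%:R -> h%:R * x = 1 + x' ->
  exists2 H : nat, (0 < H)%N & H%:R * x = (H * n)%:R.
Proof.
move=> n0 h0 xc hx.
have [c0|c0] := posnP c.
  by exists 1%N => //; rewrite mul1r mul1n; move: xc; rewrite c0 !addr0.
(* H x = c + c x' contains the free module c, so x + c = n + c can be applied inside it. *)
pose H := (h * c)%N.
have step : H%:R * x + x = H%:R * x + n%:R.
  rewrite /H natrM mulrAC hx.
  transitivity (c%:R * x' + (x + c%:R)); first by ring.
  by rewrite xc; ring.
have iter l : H%:R * x + l%:R * x = H%:R * x + (l * n)%:R.
  elim: l => [|l IHl]; first by rewrite mul0r.
  rewrite -[in LHS]addn1 natrD mulrDl mul1r addrA IHl addrAC step.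
  by rewrite -addrA -natrD mulSn.
(* By [iter], (H + H c) x = H x + H c n. As n > 0, one part H c of the free term joins H x to form H
   (x + c) = H (n + c). *)
exists (H + H * c)%N; first by rewrite /H; nia.
rewrite natrD mulrDl iter.
have -> : (H * c * n = H * c + H * c * n.-1)%N by nia.
rewrite natrD addrA natrM -mulrDr xc.
by rewrite -natrD -natrM -natrD; congr _%:R; nia.
Qed.

End Cancellation.

(** This is the constant coefficient of the quotient; its positivity will give [div_poly] a free
    summand of rank one. *)
Lemma div_coef1_gt0 B s t : all (fun c => c <= t)%N s ->
  ((size s).+1 * t < B)%N -> (0 < size s)%N -> (0 < div_coef B s 1)%N.
Proof.
case: s => // c s /= /andP[le_ct les] ltB _.
have [|pos ratio] := div_coef_ratio les (B := B); first by nia.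
by rewrite subn_gt0; have := ratio 0%N; nia.
Qed.

(** Bernoulli's inequality for (1 + 1/a)^m with a = N - 1, cleared of denominators. *)
Lemma exp_ratio_unbounded (k N : nat) : (0 < N)%N ->
  exists m, (k * N.-1 ^ m.+1 < N ^ m.+1)%N.
Proof.
case: N => // a _; exists (k * a)%N; rewrite [a.+1.-1]/=.
have bern m : ((a + m) * a ^ m <= a * a.+1 ^ m)%N.
  by elim: m => [|m IHm]; rewrite ?expn0 ?addn0 ?muln1 // !expnS; nia.
have [->|a0] := posnP a; first by rewrite exp0n // muln0 exp1n.
have := bern (k * a).+1; have : (0 < a ^ (k * a).+1)%N by rewrite expn_gt0 a0.
by nia.
Qed.

(** [Id] is the ideal generated by the powers [f j ^+ m]. Every partial sum of the [f j] has a power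
    in it, and the full sum is 1. *)
Lemma comaximal_powers (S : comNzRingType) (J : finType) (f : J -> S) m :
  \sum_j f j = 1 -> exists g : J -> S, \sum_j g j * f j ^+ m = 1.
Proof.
pose Id x := exists g : J -> S, x = \sum_j g j * f j ^+ m.
have Id0 : Id 0.
  by exists (fun=> 0); rewrite big1 // => j _; rewrite mul0r.
have IdD x y : Id x -> Id y -> Id (x + y).
  move=> [g ->] [h ->]; exists (fun j => g j + h j).
  by rewrite -big_split; apply: eq_bigr => j _; rewrite mulrDl.
have IdM x y : Id y -> Id (x * y).
  move=> [g ->]; exists (fun j => x * g j).
  by rewrite mulr_sumr; apply: eq_bigr => j _; rewrite mulrA.
have rad (r : seq J) : exists k, Id ((\sum_(j <- r) f j) ^+ k.+1).
  elim: r => [|j r [k IHk]]; first by exists 0%N; rewrite big_nil expr1.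
  exists (m + k.+1)%N; rewrite big_cons exprDn.
  apply: (big_ind Id) => // i _; rewrite -mulr_natl; apply: (IdM).
  (* Either the exponent of the tail reaches [k.+1], or that of [f j] is at least m. *)
  have [lt_ik|le_ki] := ltnP i k.+1; last first.
    by rewrite -[in _ ^+ i](subnK le_ki) exprD mulrA; exact: (IdM).
  have -> : ((m + k.+1).+1 - i = ((m + k.+1).+1 - i - m) + m)%N by lia.
  rewrite exprD mulrAC; apply: (IdM).
  exists (fun j' => (j' == j)%:R); rewrite (bigD1 j) //= eqxx mul1r big1 ?addr0//.
  by move=> j' /negPf ->; rewrite mul0r.
move=> sum1; have [k] := rad (index_enum J).
by rewrite sum1 expr1n => -[g Eg]; exists g.
Qed.

(** * Minors of an idempotent matrix *)

Section Minors.
Variables (S : comNzRingType) (N : nat) (E : 'M[S]_N).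
Hypothesis EK : E *m E = E.

Lemma idem_mx_subproof :
  fmul (fun i j : cells (Ord N) => E i j) (fun i j => E i j) = (fun i j => E i j).
Proof.
by apply: fmx_eq => i j; have := congr1 (fun M : 'M_N => M i j) EK; rewrite mxE.
Qed.
Definition idem_mx : idem S := @Idem S (Ord N) _ idem_mx_subproof.

Definition mixed_rows (I : {set 'I_N}) : 'M[S]_N :=
  \matrix_(i, j) (if i \in I then E i j else (1%:M - E) i j).

(** Expansion of det (E + (1 - E)) = 1 by multilinearity in the rows: the minors form a partition of
    unity. *)
Lemma sum_det_mixed_rows : \sum_I \det (mixed_rows I) = 1.
Proof.
rewrite -(det1 S N) [RHS]/determinant /determinant exchange_big /=.
apply: eq_bigr => s _; rewrite -mulr_sumr; congr (_ * _).
have -> : \prod_i (1%:M : 'M[S]_N) i (fun_of_perm s i) =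
    \prod_i (E i (fun_of_perm s i) + (1%:M - E) i (fun_of_perm s i)).
  by apply: eq_bigr => i _; rewrite !mxE [RHS]addrC subrK.
rewrite bigA_distr; apply: eq_bigr => I _.
by apply: eq_bigr => i _; rewrite mxE.
Qed.

Lemma mixed_rowsE I i j :
  (mixed_rows I *m E) i j = if i \in I then mixed_rows I i j else 0.
Proof.
rewrite mxE; case: ifP => iI.
  rewrite [RHS]mxE iI -[in RHS]EK [RHS]mxE.
  by apply: eq_bigr => k _; rewrite mxE iI.
transitivity (((1%:M - E) *m E) i j); last first.
  by rewrite mulmxBl mul1mx EK subrr mxE.
by rewrite [RHS]mxE; apply: eq_bigr => k _; rewrite [mixed_rows _ _ _]mxE iI.
Qed.

(* The rows of [E] indexed by [I] trivialise the image of [E] where the minor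
   is invertible. *)
Lemma minor_mf I : mf (\det (mixed_rows I)) idem_mx (ifree S (Ord #|I|)).
Proof.
(* [G *m E] vanishes outside the rows in I, so products summed over I are full matrix products. The
   composites then reduce to [\adj G *m G] and [G *m \adj G], both equal to det G. *)
set G := mixed_rows I; pose F := E *m \adj G.
pose a (i : 'I_N) (k : 'I_#|I|) : S := F i (enum_val k).
pose b (k : 'I_#|I|) (j : 'I_N) : S := (G *m E) (enum_val k) j.
have FE (M : 'M_N) : (forall i, i \notin I -> forall j, M i j = 0) ->
    forall i j, \sum_k a i k * M (enum_val k) j = (F *m M) i j.
  move=> M0 i j; rewrite mxE (bigID (mem I)) /= [X in _ + X]big1 ?addr0 => [|k kI].
    rewrite [RHS]big_enum_val; exact: eq_bigr.
  by rewrite M0 ?mulr0.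
apply: (@MF _ _ idem_mx (ifree S (Ord #|I|)) a b);
  rewrite ?fmul1l ?fmul1r //; apply: fmx_eq => i j; rewrite /fmul /=.
- have := congr1 (fun M : 'M_N => M i (enum_val j)) (mulmxA E E (\adj G)).
  by rewrite EK mxE.
- have := congr1 (fun M : 'M_N => M (enum_val i) j) (mulmxA G E E).
  by rewrite EK [RHS]mxE => <-.
- rewrite FE => [|k kI l]; last by rewrite mixed_rowsE (negPf kI).
  rewrite /F -mulmxA (mulmxA (\adj G)) mul_adj_mx mul_scalar_mx.
  by rewrite -scalemxAr EK mxE.
- have -> : \sum_k b i k * a k j = (G *m E *m F) (enum_val i) (enum_val j).
    by rewrite mxE.
  rewrite /F mulmxA -(mulmxA G) EK mxE.
  under eq_bigr do rewrite mixed_rowsE enum_valP.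
  have := congr1 (fun M : 'M_N => M (enum_val i) (enum_val j)) (mul_mx_adj G).
  rewrite mxE /= => ->.
  by rewrite mxE /fscale /fone (inj_eq enum_val_inj) mulr_natr.
Qed.

End Minors.

(** * Tensoring a faithful projective module to a free one *)

Section Bass.
Variable S : comNzRingType.

(** Each entry of [T] brings in a factor y - c and, through [mfc_tensor], adds its scalar. When the
    scalars sum to 1, the two sides agree: this is the identity that the product of the y - c is
    0. *)
Lemma alt_prod_mfc (y : pclass S) (T : seq (S * nat)) :
  (forall c, c \in T -> mfc c.1 y c.2%:R) ->
  let: (p, m) := alt_prod y [seq c.2 | c <- T] in
  mfc (\sum_(c <- T) c.1) p m.
Proof.
elim: T => [|[f c] T IHT] Ty /=; first by rewrite big_nil; exact: mf_zero.
have := IHT (fun x xT => Ty x (mem_behead (s := _ :: _) xT)).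
case: (alt_prod _ _) => p m pm; rewrite big_cons addrC; apply: mfc_tensor => //.
by apply: (Ty (f, c)); rewrite mem_head.
Qed.

Lemma pclass_complement (x : pclass S) : exists y (c : nat), x + y = c%:R.
Proof.
have [X ->] := cls_repr x; exists (cls (icompl X)), #|idx X|; exact: cls_compl.
Qed.

Section Inverse.
Variables (N : nat) (E : 'M[S]_N).
Hypothesis EK : E *m E = E.
Hypothesis E_faithful : forall c : S, c *: E = 0 -> c = 0.

Let mu := cls (idem_mx EK).

Let EK' : (1%:M - E) *m (1%:M - E) = 1%:M - E.
Proof. by rewrite mulmxBl mul1mx mulmxBr mulmx1 EK subrr subr0. Qed.

Let t := cls (idem_mx EK').

Let mu_t : mu + t = N%:R.
Proof.
have := cls_compl (idem_mx EK); rewrite [#|_|]card_ord => <-; congr (_ + _).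
apply/cls_eq/(@mf_relabel _ (idem_mx EK') (icompl (idem_mx EK)) id).
  by exists id.
by move=> i j; rewrite /= !mxE /fadd /fone /fscale mulN1r.
Qed.

Let N_gt0 : (0 < N)%N.
Proof.
rewrite lt0n; apply/negP => /eqP N0; have /eqP := oner_neq0 S; apply.
by apply: E_faithful; apply/matrixP => -[i lti]; exfalso; rewrite N0 in lti.
Qed.

(** The determinant kills E because (1 - E) E = 0. Thus faithfulness excludes the locus of rank
    0. *)
Let det0 : \det (1%:M - E) = 0.
Proof.
apply: E_faithful; rewrite -mul_scalar_mx -mul_adj_mx -mulmxA.
by rewrite mulmxBl mul1mx EK subrr mulmx0.
Qed.

(** For nonempty I, one basis vector of the trivialisation [minor_mf] gives u and v with u v = f I;
    for empty I, f I = 0 by [det0]. Since the f I sum to 1, these assemble to a unimodular pair on h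
    copies of E, one for each I. *)
Lemma faithful_unimodular : exists (h : nat) x,
  (0 < h)%N /\ h%:R * mu = 1 + x.
Proof.
pose f (I : {set 'I_N}) := \det (mixed_rows E I).
have /choice [uv uvP] I : exists uv : ('I_N -> S) * ('I_N -> S),
    [/\ forall j, \sum_i uv.1 i * E i j = uv.1 j,
        forall i, \sum_j E i j * uv.2 j = uv.2 i
      & \sum_i uv.1 i * uv.2 i = f I].
  have [I0|/card_gt0P[i0 i0I]] := posnP #|I|.
    exists (fun=> 0, fun=> 0); split=> [j|i|] /=; try by
      rewrite big1 // => k _; rewrite ?mul0r ?mulr0.
    rewrite big1 => [|k _]; last by rewrite mul0r.
    rewrite -det0 /f; congr (\det _); apply/matrixP => i j.
    by rewrite (cards0_eq I0) !mxE inE.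
  have [a b h1 h2 h3 h4 h5 h6] := minor_mf EK I.
  pose k : 'I_#|I| := enum_rank_in i0I i0.
  exists (b k, a^~ k); split=> [j|i|] /=.
  - exact: (congr1 (fun M => M k j) h4).
  - exact: (congr1 (fun M => M i k) h1).
  - rewrite -[LHS]/(fmul b a k k) h6 /fscale /= /fone.
    by rewrite eqxx mulr1.
pose h := #|{set 'I_N}|.
have h_gt0 : (0 < h)%N by apply/card_gt0P; exists set0.
pose X := imul (ifree S (Ord h)) (idem_mx EK).
pose u (p : 'I_h * 'I_N) : S := (uv (enum_val p.1)).1 p.2.
pose v (p : 'I_h * 'I_N) : S := (uv (enum_val p.1)).2 p.2.
have [|||x Ex] := @cls_unimodular S X u v; last first.
- by exists h, x; split=> //; rewrite -Ex clsM cls_ifree_ord.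
- rewrite -(sum_det_mixed_rows E).
  rewrite -(pair_bigA _ (fun i j => u (i, j) * v (i, j))) /=.
  rewrite [RHS](reindex _ (onW_bij _ (enum_val_bij _))) /=.
  by apply: eq_bigr => i _; case: (uvP (enum_val i)).
- move=> [i j]; rewrite /= /ftens /=.
  rewrite -(pair_bigA _ (fun k l => fone _ i k * E j l * v (k, l))) /=.
  rewrite (bigD1 i) //= [X in _ + X]big1 => [|k]; last first.
    rewrite eq_sym => /negPf ki; apply: big1 => l _.
    by rewrite /fone ki !mul0r.
  rewrite addr0 /fone eqxx; under eq_bigr do rewrite mul1r.
  by case: (uvP (enum_val i)).
- move=> [i j]; rewrite /= /ftens /=.
  rewrite -(pair_bigA _ (fun k l => u (k, l) * (fone _ k i * E l j))) /=.
  rewrite (bigD1 i) //= [X in _ + X]big1 => [|k]; last first.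
    by move=> /negPf ki; apply: big1 => l _; rewrite /fone ki mul0r mulr0.
  rewrite addr0 /fone eqxx; under eq_bigr do rewrite mul1r.
  by case: (uvP (enum_val i)).
Qed.

(** The factorization of N^(m+1) - t^(m+1) by N - t = [mu], without subtraction. The form 1 + v of
    the cofactor will provide a free summand after multiplication by [h] copies of [mu]. *)
Lemma rank_power_split m : exists v : pclass S,
  N%:R ^+ m.+1 = mu * (1 + v) + t ^+ m.+1.
Proof.
elim: m => [|m [v IHv]]; first by exists 0; rewrite addr0 mulr1 !expr1 mu_t.
exists ((N ^ m.+1).-1%:R + t * (1 + v)).
have -> : 1 + ((N ^ m.+1).-1%:R + t * (1 + v)) = N%:R ^+ m.+1 + t * (1 + v).
  by rewrite addrA -natrX nat1r prednK // expn_gt0 N_gt0.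
rewrite [in LHS]exprS -[X in X * _]mu_t mulrDl mulrDr -addrA; congr (_ + _).
rewrite IHv (exprS t m.+1) mulrDr; congr (_ + _); exact: mulrCA.
Qed.

(* A theorem of Bass. In the semiring of classes [mu = N - t], and the power
   [y = t ^ m] is killed by [\prod_I (y - #|I| ^ m)] over proper subsets [I].
   Modulo this product, [N ^ m - y], a multiple of [mu], divides the integer
   [\prod_I (N ^ m - #|I| ^ m)], and for large [m] the quotient has nonnegative
   coefficients, hence is the class of a module. *)
Theorem faithful_projective_tensor_free : exists (Q : idem S) (n : nat),
  (0 < n)%N /\ mf 1 (imul (idem_mx EK) Q) (ifree S (Ord n)).
Proof.
pose k := #|{set 'I_N}|.
(* There are k constants in the product, each at most (N - 1)^(m+1); this m makes B = N^(m+1) large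
   enough for [div_polyP]. *)
have [m ltm] := exp_ratio_unbounded k.+1 N_gt0.
pose f (I : {set 'I_N}) := \det (mixed_rows (1%:M - E) I).
have [g sumg] := comaximal_powers m.+1 (sum_det_mixed_rows (1%:M - E)).
(* For the full set, f I = det (1 - E) = 0 and any constant is allowed; 0 respects the bound (N -
   1)^(m+1), unlike N^(m+1). *)
pose sig (I : {set 'I_N}) := (if I == setT then 0 else #|I| ^ m.+1)%N.
pose T := map (fun I => (g I * f I ^+ m.+1, sig I)) (enum {set 'I_N}).
pose y := t ^+ m.+1; pose B := (N ^ m.+1)%N; pose s := [seq c.2 | c <- T].
have size_s : size s = k by rewrite /s /T size_map size_map -cardE.
have s_le : all (fun c => c <= N.-1 ^ m.+1)%N s.
  rewrite /s /T -map_comp; apply/allP => _ /mapP[I _ ->] /=; rewrite /sig.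
  case: ifP => // /negbT IT; rewrite leq_exp2r // -ltnS prednK //.
  rewrite -[X in (_ < X)%N]card_ord -cardsT; apply: proper_card.
  by rewrite properEneq IT subsetT.
have lt_B : ((size s).+1 * N.-1 ^ m.+1 < B)%N by rewrite size_s.
have := @alt_prod_mfc y T; rewrite -/s.
have [z Ez] := div_polyP y s_le lt_B.
have n_gt0 := (div_coef_ratio s_le lt_B).1.
move: Ez n_gt0; move: (div_coef B s 0) => n Ez n_gt0.
case: (alt_prod y s) Ez => p q /= Ez.
rewrite big_map big_enum /= sumg => pq.
have {pq} pq : p = q.
  apply/mfc1/pq => _ /mapP[I _ ->] /=; apply: mf_scale; rewrite /sig.
  case: eqP => [->|_].
    have -> : f setT = 0.
      rewrite /f -det0; congr (\det _); apply/matrixP => i j.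
      by rewrite mxE inE.
    by rewrite expr0n; exact: mf_zero.
  rewrite natrX; apply: mfcX; rewrite -cls_ifree_ord.
  by apply/mfcE; exact: minor_mf.
have [v Ev] := rank_power_split m.
set w := div_poly y B s in Ez.
have [w' Ew] : exists w', w = 1 + w'.
  have k_gt0 : (0 < k)%N by apply/card_gt0P; exists set0.
  have pos : (0 < div_coef B s 1)%N.
    by apply: (div_coef1_gt0 s_le lt_B); rewrite size_s.
  rewrite /w /div_poly size_s -(prednK k_gt0) big_ord_recl expr0 mulr1.
  exists ((div_coef B s 1).-1%:R +
    \sum_(i < k.-1) (div_coef B s (lift ord0 i).+1)%:R * y ^+ lift ord0 i).
  by rewrite addrA nat1r (prednK pos).
pose theta := mu * (1 + v) * w.
(* A complement turns the stabilising term into a free one, as [stably_free_multiple] requires. *)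
have [x [c xc]] := pclass_complement (y * w + p + z).
have Etheta : theta + c%:R = n%:R + c%:R.
  rewrite -xc.
  transitivity ((mu * (1 + v) + y) * w + p + z + x); first by rewrite /theta; ring.
  by rewrite -Ev -natrX -/B Ez -pq; ring.
have [h [mu' [h_gt0 Emu]]] := faithful_unimodular.
have Eh : h%:R * theta = 1 + (mu' * (1 + v) * w + v * w + w').
  rewrite /theta !mulrA Emu Ew; ring.
have [H H_gt0 EH] := stably_free_multiple n_gt0 h_gt0 Etheta Eh.
(* With this Q, [mu] times Q is H theta, which is free of rank H n. *)
have [Q EQ] := cls_repr (H%:R * (1 + v) * w).
exists Q, (H * n)%N; split; first by rewrite muln_gt0 H_gt0.
apply: cls_inj; rewrite clsM -EQ cls_ifree_ord -EH /theta -/mu; ring.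
Qed.

End Inverse.
End Bass.

(** * Constant dual bases and modules with a constant basis *)

Section DualBasis.
Variables (R : comNzRingType) (M : lmodType R).

Lemma dual_basis_projective N (x : 'I_N -> M) (f : 'I_N -> {scalar M}) :
  (forall m, m = \sum_i f i m *: x i) -> finitely_generated M /\ projective M.
Proof.
move=> xf; split; first by exists N, x => m; exists (f^~ m).
move=> U V g p g_surj.
have /choice [u uP] i : exists u, g u = p (x i) by exact: g_surj.
pose h m := \sum_i f i m *: u i.
have hL : linear h.
  move=> c m m'; rewrite /h scaler_sumr -big_split; apply: eq_bigr => i _.
  by rewrite linearP scalerDl scalerA.
pose H : {linear M -> U} := HB.pack h (GRing.isLinear.Build _ _ _ _ h hL).
exists H => m; rewrite /= [in RHS](xf m) !linear_sum; apply: eq_bigr => i _.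
by rewrite !linearZ uP.
Qed.

Lemma projective_dual_basis : finitely_generated M -> projective M ->
  exists N (x : 'I_N -> M) (f : 'I_N -> {scalar M}),
    forall m, m = \sum_i f i m *: x i.
Proof.
move=> [N [x xgen]] Mproj.
pose g (c : 'rV[R]_N) := \sum_i c 0 i *: x i.
have gL : linear g.
  move=> a c c'; rewrite /g scaler_sumr -big_split; apply: eq_bigr => i _.
  by rewrite !mxE scalerDl scalerA.
pose G : {linear 'rV[R]_N -> M} := HB.pack g (GRing.isLinear.Build _ _ _ _ g gL).
have [m|h hP] := Mproj _ _ G idfun.
  have [c ->] := xgen m; exists (\row_i c i); apply: eq_bigr => i _.
  by rewrite mxE.
have fL i : scalar (fun m => h m 0 i) by move=> a m m'; rewrite linearP !mxE.
pose F i : {scalar M} := HB.pack (fun m => h m 0 i)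
  (GRing.isLinear.Build _ _ _ _ (fun m => h m 0 i) (fL i)).
exists N, x, F.
by move=> m; have := hP m.
Qed.

End DualBasis.

(* The dual basis shows that A is a direct summand, as a differential module, of
   a free module with a basis of constants. *)
Definition constant_dual_basis (R : comNzRingType) (D : derivation R)
    (A : algType R) (DA : derivation A) : Prop :=
  exists N (y : 'I_N -> A) (psi : 'I_N -> {scalar A}),
    [/\ forall i, DA (y i) = 0, forall i a, psi i (DA a) = D (psi i a)
      & forall a, a = \sum_i psi i a *: y i].

(** The matrices act on row vectors from the right, so a left module corresponds to a map that
    reverses products. *)
Record antirep (R : comNzRingType) (A : algType R) (n : nat) := Antirep {
  arep :> A -> 'M[R]_n;
  arepD : {morph arep : a b / a + b};
  arepZ : forall c a, arep (c *: a) = c *: arep a;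
  arep1 : arep 1 = 1%:M;
  arepM : forall a b, arep (a * b) = arep b *m arep a
}.

Definition antirep_mod (R : comNzRingType) (A : algType R) n (r : antirep A n) :
  Type := 'rV[R]_n.

Section AntirepMod.
Variables (R : comNzRingType) (A : algType R) (n : nat) (r : antirep A n).
Local Notation P := (antirep_mod r).

HB.instance Definition _ := GRing.Zmodule.on P.

Definition antirep_scale (a : A) (v : P) : P := (v : 'rV_n) *m r a.

Fact antirep_scaleA a b v :
  antirep_scale a (antirep_scale b v) = antirep_scale (a * b) v.
Proof. by rewrite /antirep_scale arepM mulmxA. Qed.

Fact antirep_scale1 : left_id 1 antirep_scale.
Proof. by move=> v; rewrite /antirep_scale arep1 mulmx1. Qed.

Fact antirep_scaleDr : right_distributive antirep_scale +%R.
Proof. by move=> a u v; exact: mulmxDl. Qed.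

Fact antirep_scaleDl v : {morph antirep_scale^~ v : a b / a + b}.
Proof. by move=> a b; rewrite /antirep_scale arepD mulmxDr. Qed.

HB.instance Definition _ := GRing.Zmodule_isLmodule.Build A P
  antirep_scaleA antirep_scale1 antirep_scaleDr antirep_scaleDl.

Lemma antirep_modZ (c : R) (v : restrict P) : c *: v = c *: (v : 'rV_n) :> 'rV_n.
Proof.
rewrite -[LHS]/((v : 'rV_n) *m r c%:A) arepZ arep1.
by rewrite -scalemxAr mulmx1.
Qed.

Lemma antirep_mod_sum (v : restrict P) :
  v = \sum_(i < n) ((v : 'rV_n) 0 i) *: (delta_mx 0 i : restrict P).
Proof.
rewrite [LHS](row_sum_delta (v : 'rV_n)); apply: eq_bigr => i _.
by rewrite antirep_modZ.
Qed.

Lemma antirep_mod_basis :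
  is_basis (fun i : 'I_n => delta_mx 0 i : restrict P).
Proof.
move=> v; exists [ffun i => (v : 'rV_n) 0 i]; split=> [|c ->].
  by rewrite [LHS]antirep_mod_sum; apply: eq_bigr => i _; rewrite ffunE.
apply/ffunP => i; rewrite ffunE; under eq_bigr do rewrite antirep_modZ.
rewrite -[\sum_(i < n) _]/(\sum_(j < n) c j *: delta_mx 0 j : 'rV_n).
rewrite summxE (bigD1 i) //= big1 ?addr0 => [|j /negPf ji].
  by rewrite !mxE !eqxx mulr1.
by rewrite !mxE eqxx eq_sym ji mulr0.
Qed.

End AntirepMod.

Section DerivationSum.
Variables (R : pzRingType) (D : derivation R).

Lemma der_sum (I : Type) (r : seq I) (P : pred I) (F : I -> R) :
  D (\sum_(i <- r | P i) F i) = \sum_(i <- r | P i) D (F i).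
Proof. exact: (big_morph _ (derD D) (der0 D)). Qed.

End DerivationSum.

Lemma extends_derivationZ (R : comNzRingType) (D : derivation R) (A : algType R)
    (DA : derivation A) : extends_derivation D DA ->
  forall r a, DA (r *: a) = D r *: a + r *: DA a.
Proof.
by move=> hDA r a; rewrite -[r *: a]mulr_algl derM hDA !mulr_algl.
Qed.

Section ConstantsEmbedding.
Variables (R : comNzRingType) (D : derivation R).

Definition embed (c : constants D) : R := val c.

HB.instance Definition _ :=
  GRing.RMorphism.copy embed (val : constants D -> R).

Lemma embed_inj : injective embed. Proof. exact: val_inj. Qed.

Lemma der_embed c : D (embed c) = 0. Proof. exact: der_cval. Qed.

Lemma der0_embed x : D x = 0 -> exists c, embed c = x.
Proof.
move=> /eqP Dx; have xD : x \in Defs.constant D by [].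
by exists (Constants xD).
Qed.

Definition fembed (I J : finType) (M : I -> J -> constants D) : I -> J -> R :=
  fun i j => embed (M i j).

Lemma fembed_mul (I J L : finType) (M : I -> J -> constants D)
    (M' : J -> L -> constants D) :
  fembed (fmul M M') = fmul (fembed M) (fembed M').
Proof.
apply: fmx_eq => i l; rewrite /fembed rmorph_sum.
by apply: eq_bigr => j _; rewrite rmorphM.
Qed.

Lemma fembed_tens (I J I' J' : finType) (M : I -> J -> constants D)
    (M' : I' -> J' -> constants D) :
  fembed (ftens M M') = ftens (fembed M) (fembed M').
Proof. by apply: fmx_eq => i l; rewrite /fembed rmorphM. Qed.

End ConstantsEmbedding.

(** * From a constant dual basis to a module with a constant basis *)

Section ModuleFromDualBasis.
Variables (R : comNzRingType) (D : derivation R).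
Variables (A : algType R) (DA : derivation A).
Hypothesis A_faithful : faithful A.
Variables (N : nat) (y : 'I_N -> A) (psi : 'I_N -> {scalar A}).
Hypotheses (DAy : forall i, DA (y i) = 0)
  (psiD : forall i a, psi i (DA a) = D (psi i a))
  (psiK : forall a, a = \sum_i psi i a *: y i).
Local Notation S := (constants D).

(** Left multiplication by [a] in dual basis coordinates; [lmat 1] is the idempotent whose image is
    A. *)
Let lmat (a : A) : 'I_N -> 'I_N -> R := fun i j => psi j (a * y i).

Let lmatM a b : fmul (lmat b) (lmat a) = lmat (a * b).
Proof.
apply: fmx_eq => i l; rewrite /fmul /lmat -mulrA {2}(psiK (b * y i)).
rewrite mulr_sumr linear_sum; apply: eq_bigr => j _.
by rewrite -scalerAr linearZ.
Qed.

Let proj_const : exists E : 'M[S]_N, forall i j, embed (E i j) = psi j (y i).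
Proof.
have /choice [F FP] (p : 'I_N * 'I_N) : exists c : S, embed c = psi p.2 (y p.1).
  by apply: der0_embed; rewrite -psiD DAy linear0.
by exists (\matrix_(i, j) F (i, j)) => i j; rewrite mxE FP.
Qed.

(** The idempotent [lmat 1] comes from a matrix E over R^D. Its image becomes free after tensoring
    with some Q over R^D, and A acts on the base change of this free module through its own
    factor. *)
Lemma constant_antirep : exists n (r : antirep A n.+1),
  injective r /\ forall a, r (DA a) = map_mx D (r a).
Proof.
have [E EP] := proj_const.
have fE : fembed (fun i j => E i j) = lmat 1.
  by apply: fmx_eq => i j; rewrite /fembed EP /lmat mul1r.
have EK : E *m E = E.
  apply/matrixP => i j; apply: embed_inj; rewrite mxE.
  rewrite -[LHS]/(fembed (fmul (fun i j => E i j) (fun i j => E i j)) i j).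
  by rewrite fembed_mul fE lmatM mulr1 -fE.
(* If c E = 0 then c kills every psi_j(y_i), hence the generators y_i, hence A. *)
have E_faithful c : c *: E = 0 -> c = 0.
  move=> cE; apply: embed_inj; rewrite rmorph0; apply: A_faithful => a.
  rewrite [a]psiK scaler_sumr big1 // => i _.
  rewrite scalerA mulrC -scalerA [y i]psiK scaler_sumr big1 ?scaler0 // => j _.
  rewrite scalerA -EP -rmorphM.
  have := congr1 (fun M : 'M_N => M i j) cE; rewrite !mxE => ->.
  by rewrite rmorph0 scale0r.
have [Q [[|n] [// n_gt0 [a0 b0 _ _ _ h4 h5 h6]]]] :=
  faithful_projective_tensor_free EK E_faithful.
pose q := fembed Q; pose V := fembed a0; pose U := fembed b0.
have qK : fmul q q = q by rewrite -fembed_mul imxK.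
have VU : fmul V U = ftens (lmat 1) q.
  by rewrite -fembed_mul h5 fscale1 /= fembed_tens -fE.
have UV : fmul U V = fone _.
  rewrite -fembed_mul h6 fscale1 /=; apply: fmx_eq => i j.
  by rewrite /fembed /fone rmorph_nat.
have UX : fmul U (ftens (lmat 1) q) = U.
  by rewrite -VU fmulA UV fmul1l.
(* D acts only on the factor [lmat a], since U, V and q have constant entries. *)
pose rf a := fmul U (fmul (ftens (lmat a) q) V).
pose r0 a : 'M[R]_n.+1 := \matrix_(i, j) rf a i j.
have lin c a b : rf (c *: a + b) = fadd (fscale c (rf a)) (rf b).
  rewrite /rf -fmulZr -fmulDr -fmulZl -fmulDl; congr fmul; congr fmul.
  apply: fmx_eq => i j; rewrite /ftens /lmat /fadd /fscale mulrDl -scalerAl.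
  by rewrite linearP /= mulrDl mulrA.
have rf1 : rf 1 = fone _ by rewrite /rf fmulA UX UV.
have rfM a b : rf (a * b) = fmul (rf b) (rf a).
  transitivity (fmul U (fmul (fmul (ftens (lmat b) q)
    (fmul (fmul V U) (ftens (lmat a) q))) V)); last by rewrite /rf -!fmulA.
  by rewrite VU !fmul_tens !qK !lmatM mulr1.
have r0P c a b : r0 (c *: a + b) = c *: r0 a + r0 b.
  by apply/matrixP => i j; rewrite !mxE lin.
have r0D : {morph r0 : a b / a + b}.
  by move=> a b; rewrite -[a]scale1r r0P !scale1r.
have r00 : r0 0 = 0 by apply: (@addrI _ (r0 0)); rewrite -r0D !addr0.
have r0Z c a : r0 (c *: a) = c *: r0 a.
  by rewrite -[c *: a]addr0 r0P r00 addr0.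
have r01 : r0 1 = 1%:M by apply/matrixP => i j; rewrite !mxE rf1.
have r0M a b : r0 (a * b) = r0 b *m r0 a.
  apply/matrixP => i j; rewrite !mxE rfM; apply: eq_bigr => k _.
  by rewrite !mxE.
exists n, (Antirep r0D r0Z r01 r0M); split=> [a b /= ab|a]; last first.
  apply/matrixP => i j; rewrite !mxE /= /rf /fmul der_sum; apply: eq_bigr => k _.
  rewrite derM der_embed mul0r add0r der_sum; congr (_ * _).
  apply: eq_bigr => l _; rewrite derM der_embed mulr0 addr0; congr (_ * _).
  rewrite /ftens derM der_embed mulr0 addr0 /lmat -psiD derM DAy.
  by rewrite mulr0 addr0.
suff inj0 c : r0 c = 0 -> c = 0.
  apply/eqP; rewrite -subr_eq0; apply/eqP/inj0.
  by rewrite r0D -scaleN1r r0Z ab scaleN1r subrr.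
move=> c0; have rc : rf c = fzero _ _.
  apply: fmx_eq => i j.
  by have := congr1 (fun M : 'M_n.+1 => M i j) c0; rewrite !mxE.
have cq : ftens (lmat c) q = fzero _ _.
  transitivity (fmul V (fmul (rf c) U)); last by rewrite rc fmul0l fmul0r.
  rewrite /rf -!fmulA VU fmulA VU !fmul_tens !qK !lmatM.
  by rewrite mulr1 mul1r.
have lc i j : lmat c i j = 0.
  rewrite -[LHS]mulr1.
  (* As U V = U (lmat 1 (x) q) V, this writes 1 as a combination of entries of q, and [cq] says that
     every entry of [lmat c] kills those entries. *)
  have -> : 1 = fmul U V ord0 ord0 by rewrite UV /fone eqxx.
  rewrite -UX -fmulA /fmul mulr_sumr big1 // => p _.
  rewrite mulrCA mulr_sumr big1 ?mulr0 // => p' _.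
  have := congr1 (fun M => M (i, p.2) (j, p'.2)) cq.
  rewrite /ftens /fzero /= => cq0.
  by rewrite mulrA [lmat c i j * _]mulrCA cq0 mulr0 mul0r.
have cy i : c * y i = 0.
  by rewrite [LHS]psiK big1 // => j _; rewrite -/(lmat c i j) lc scale0r.
by rewrite -[c]mulr1 [1]psiK mulr_sumr big1 // => i _; rewrite -scalerAr cy scaler0.
Qed.

Lemma dual_basis_module : exists (P : lmodType A) (DP : {additive P -> P}),
  [/\ differential_module DA DP, faithful P, finitely_generated (restrict P),
      projective (restrict P)
    & exists (n : nat) (b : 'I_n -> restrict P),
        is_basis b /\ (forall i, DP (b i) = 0)].
Proof.
have [n [r [r_inj rD]]] := constant_antirep.
pose P : lmodType A := antirep_mod r.
pose dp (v : P) : P := map_mx D (v : 'rV[R]_n.+1).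
have dpB : zmod_morphism dp.
  move=> u v; apply/matrixP => i j; rewrite !mxE derD derN //.
pose DP : {additive P -> P} := HB.pack dp (GRing.isZmodMorphism.Build _ _ dp dpB).
have D01 (b : bool) : D b%:R = 0 by case: b; rewrite ?der0 ?der1.
have fL i : scalar (fun v : restrict P => (v : 'rV[R]_n.+1) 0 i).
  by move=> c u v; rewrite mxE antirep_modZ mxE.
pose F i : {scalar (restrict P)} := HB.pack
  (fun v : restrict P => (v : 'rV[R]_n.+1) 0 i)
  (GRing.isLinear.Build _ _ _ _ _ (fL i)).
have [fgP projP] := dual_basis_projective (f := F) (@antirep_mod_sum _ _ _ r).
exists P, DP; split.
- move=> a v; apply/matrixP => i j; rewrite !mxE der_sum -big_split /=.
  by apply: eq_bigr => k _; rewrite derM rD !mxE addrC.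
- move=> a a0; apply: r_inj; apply/row_matrixP => i.
  rewrite !rowE; have := a0 (delta_mx 0 i).
  rewrite -[a *: _]/(delta_mx 0 i *m r a) => ->.
  have -> : r 0 = 0 by apply: (@addrI _ (r 0)); rewrite -arepD !addr0.
  by rewrite mulmx0.
- exact: fgP.
- exact: projP.
- exists n.+1, (fun i => delta_mx 0 i); split; first exact: antirep_mod_basis.
  by move=> i; apply/matrixP => j k; rewrite !mxE D01.
Qed.

End ModuleFromDualBasis.

(** * The equivariant projection onto a differential Azumaya subalgebra *)

Section MatrixDerivation.
Variables (R : comNzRingType) (D : derivation R) (n : nat).
Implicit Types X Y : 'M[R]_n.+1.

Lemma map_derD X Y : map_mx D (X + Y) = map_mx D X + map_mx D Y.
Proof. by apply/matrixP => i j; rewrite !mxE derD. Qed.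

Lemma map_der0 : map_mx D (0 : 'M[R]_n.+1) = 0.
Proof. by apply/matrixP => i j; rewrite !mxE der0. Qed.

Lemma map_der_sum (I : Type) (r : seq I) (F : I -> 'M[R]_n.+1) :
  map_mx D (\sum_(i <- r) F i) = \sum_(i <- r) map_mx D (F i).
Proof. exact: (big_morph _ map_derD map_der0). Qed.

Lemma map_derM X Y : map_mx D (X * Y) = map_mx D X * Y + X * map_mx D Y.
Proof.
apply/matrixP => i j; rewrite !mxE der_sum -big_split.
by apply: eq_bigr => k _; rewrite derM !mxE.
Qed.

Lemma map_der_delta i j : map_mx D (delta_mx i j : 'M[R]_n.+1) = 0.
Proof.
by apply/matrixP => k l; rewrite !mxE; case: (_ && _); rewrite ?der1 ?der0.
Qed.

End MatrixDerivation.

(** Allows identities in A (x) A to be checked on the endomorphisms they induce. *)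
Lemma sandwich_inj (R : comNzRingType) (A : algType R) (t t' : tens A A) :
  azumaya A -> sandwich t =1 sandwich t' -> t = t'.
Proof.
move=> [_ _ _ hA] tt'.
pose f : {linear A -> A} := HB.pack (sandwich t)
  (GRing.isLinear.Build _ _ _ _ _ (sandwich_linear t)).
have [u [_ uP]] := hA f; rewrite -(uP t) // -(uP t') //.
by move=> x; rewrite /= tt'.
Qed.

Lemma sandwich_sum (R : comNzRingType) (A : algType R) (I : Type) (r : seq I)
    (t : I -> tens A A) x :
  sandwich (\sum_(i <- r) t i) x = \sum_(i <- r) sandwich (t i) x.
Proof.
apply: (big_morph (fun t => sandwich t x)) => [u v|]; first exact: sandwichD.
exact: tens_lift0 (sandwich_bal x).
Qed.

Section TensorBimodule.
Variables (R : comNzRingType) (A : algType R).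
Implicit Types (t : tens A A) (a b c : A).

Lemma tens_mull_bal c : balanced (fun a b : A => tensor (c * a) b : tens A A).
Proof.
split=> [b a a'|a b b'|r a b] /=; rewrite ?mulrDr ?tensorDl ?tensorDr //.
by rewrite -scalerAr tensorZ.
Qed.

Lemma tens_mulr_bal c : balanced (fun a b : A => tensor a (b * c) : tens A A).
Proof.
split=> [b a a'|a b b'|r a b] /=; rewrite ?mulrDl ?tensorDl ?tensorDr //.
by rewrite tensorZ -scalerAl.
Qed.

Definition tens_mull c : tens A A -> tens A A :=
  tens_lift (fun a b => tensor (c * a) b).
Definition tens_mulr c : tens A A -> tens A A :=
  tens_lift (fun a b => tensor a (b * c)).

Lemma sandwich_mull c t x : sandwich (tens_mull c t) x = c * sandwich t x.
Proof.
elim/tens_ind: t => [|a b|t u IHt IHu].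
- rewrite /tens_mull (tens_lift0 (tens_mull_bal c)) /sandwich.
  by rewrite (tens_lift0 (sandwich_bal x)) mulr0.
- by rewrite /tens_mull (tens_liftE (tens_mull_bal c)) !sandwichE !mulrA.
- by rewrite /tens_mull (tens_liftD (tens_mull_bal c)) !sandwichD IHt IHu mulrDr.
Qed.

Lemma sandwich_mulr c t x : sandwich (tens_mulr c t) x = sandwich t x * c.
Proof.
elim/tens_ind: t => [|a b|t u IHt IHu].
- rewrite /tens_mulr (tens_lift0 (tens_mulr_bal c)) /sandwich.
  by rewrite (tens_lift0 (sandwich_bal x)) mul0r.
- by rewrite /tens_mulr (tens_liftE (tens_mulr_bal c)) !sandwichE !mulrA.
- by rewrite /tens_mulr (tens_liftD (tens_mulr_bal c)) !sandwichD IHt IHu mulrDl.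
Qed.

Variables (E : algType R) (rho : {lrmorphism A -> E}).
Implicit Types (m e : E).

(** The action of A (x) A^op on E, an A-bimodule through [rho]; it extends [sandwich] by
    [act_sandwich_rho]. *)
Definition act_sandwich t m : E := tens_lift (fun a b => rho a * m * rho b) t.

Lemma act_sandwich_bal m : balanced (fun a b => rho a * m * rho b).
Proof.
split=> [b a a'|a b b'|r a b] /=.
- by rewrite rmorphD !mulrDl.
- by rewrite rmorphD mulrDr.
- by rewrite !linearZ /= -!scalerAl scalerAr.
Qed.

Lemma act_sandwichE a b m : act_sandwich (tensor a b) m = rho a * m * rho b.
Proof. exact: tens_liftE (act_sandwich_bal m) a b. Qed.

Lemma act_sandwichD m : {morph act_sandwich^~ m : t u / t + u}.
Proof. exact: tens_liftD (act_sandwich_bal m). Qed.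

Lemma act_sandwich0 m : act_sandwich 0 m = 0.
Proof. exact: tens_lift0 (act_sandwich_bal m). Qed.

Lemma act_sandwich_linear t : linear (act_sandwich t).
Proof.
move=> r x y; rewrite /act_sandwich /tens_lift scaler_sumr -big_split /=.
by apply: eq_bigr => p _; rewrite mulrDr mulrDl -scalerAr -scalerAl.
Qed.
HB.instance Definition _ t := GRing.isLinear.Build R E E *:%R (act_sandwich t)
  (act_sandwich_linear t).

Lemma act_sandwich_mull c t m :
  act_sandwich (tens_mull c t) m = rho c * act_sandwich t m.
Proof.
elim/tens_ind: t => [|a b|t u IHt IHu].
- by rewrite /tens_mull (tens_lift0 (tens_mull_bal c)) !act_sandwich0 mulr0.
- rewrite /tens_mull (tens_liftE (tens_mull_bal c)) !act_sandwichE.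
  by rewrite rmorphM !mulrA.
- rewrite /tens_mull (tens_liftD (tens_mull_bal c)) !act_sandwichD.
  by rewrite IHt IHu mulrDr.
Qed.

Lemma act_sandwich_mulr c t m :
  act_sandwich (tens_mulr c t) m = act_sandwich t m * rho c.
Proof.
elim/tens_ind: t => [|a b|t u IHt IHu].
- by rewrite /tens_mulr (tens_lift0 (tens_mulr_bal c)) !act_sandwich0 mul0r.
- rewrite /tens_mulr (tens_liftE (tens_mulr_bal c)) !act_sandwichE.
  by rewrite rmorphM !mulrA.
- rewrite /tens_mulr (tens_liftD (tens_mulr_bal c)) !act_sandwichD.
  by rewrite IHt IHu mulrDl.
Qed.

Definition centralising e := forall a, rho a * e = e * rho a.

Lemma act_sandwich_centr t m e : centralising e ->
  act_sandwich t (m * e) = act_sandwich t m * e.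
Proof.
move=> eC; rewrite /act_sandwich /tens_lift mulr_suml; apply: eq_bigr => p _.
by rewrite -!mulrA eC.
Qed.

Lemma act_sandwich_centl t m e : centralising e ->
  act_sandwich t (e * m) = e * act_sandwich t m.
Proof.
move=> eC; rewrite /act_sandwich /tens_lift mulr_sumr; apply: eq_bigr => p _.
by rewrite !mulrA eC.
Qed.

Lemma act_sandwich_rho t a : act_sandwich t (rho a) = rho (sandwich t a).
Proof.
elim/tens_ind: t => [|b c|t u IHt IHu].
- by rewrite act_sandwich0 /sandwich (tens_lift0 (sandwich_bal a)) rmorph0.
- by rewrite act_sandwichE sandwichE !rmorphM.
- by rewrite act_sandwichD sandwichD IHt IHu rmorphD.
Qed.

(* For A Azumaya, E is A (x) C with C the centraliser of A: the elements [u k]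
   of A (x) A representing the coordinate forms of a dual basis give the
   coordinates of E with values in C. *)
Lemma azumaya_coordinates : azumaya A ->
  exists N (x : 'I_N -> A) (f : 'I_N -> {scalar A}) (u : 'I_N -> tens A A),
    [/\ forall a, a = \sum_k f k a *: x k,
        forall k a e, centralising e ->
          act_sandwich (u k) (rho a * e) = f k a *: e,
        forall k m, centralising (act_sandwich (u k) m)
      & forall m, m = \sum_k rho (x k) * act_sandwich (u k) m].
Proof.
move=> hA; have [fgA prA _ surj] := hA.
have [N [x [f xf]]] := projective_dual_basis fgA prA.
have /choice [u uP] k : exists u : tens A A, forall a, sandwich u a = (f k a)%:A.
  have gL : linear (fun a => (f k a)%:A : A).
    by move=> r a b; rewrite linearP scalerDl scalerA.
  pose g : {linear A -> A} := HB.pack (fun a => (f k a)%:A : A)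
    (GRing.isLinear.Build _ _ _ _ _ gL).
  by have [u [uP _]] := surj g; exists u.
exists N, x, f, u; split=> // [k a e eC|k m a|m].
- by rewrite act_sandwich_centr // act_sandwich_rho uP linearZ rmorph1 mulr_algl.
(* [u k] takes scalar values, so multiplying it by [a] on either side induces the same endomorphism
   of A. *)
- rewrite -act_sandwich_mull -act_sandwich_mulr; congr act_sandwich.
  apply: (sandwich_inj hA) => b.
  by rewrite sandwich_mull sandwich_mulr uP mulr_algl mulr_algr.
(* Both sides induce the identity of A, by the dual basis formula. *)
- have u1 : \sum_k tens_mull (x k) (u k) = tensor 1 1.
    apply: (sandwich_inj hA) => a; rewrite sandwich_sum sandwichE mul1r mulr1.
    by rewrite [RHS]xf; apply: eq_bigr => k _; rewrite sandwich_mull uP mulr_algr.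
  have := congr1 (act_sandwich^~ m) u1; rewrite act_sandwichE rmorph1 mul1r mulr1.
  move=> {1}<-; rewrite (big_morph _ (act_sandwichD m) (act_sandwich0 m)).
  by apply: eq_bigr => k _; rewrite act_sandwich_mull.
Qed.

End TensorBimodule.

Section DeltaProducts.
Variables (R : comNzRingType) (n : nat).
Implicit Types X Z : 'M[R]_n.+1.

Lemma delta_mulE X i j k l : (delta_mx i j * X) k l = (k == i)%:R * X j l.
Proof.
rewrite mxE (bigD1 j) //= big1 => [|h /negPf hj]; rewrite mxE.
  by rewrite eqxx andbT addr0.
by rewrite hj andbF mul0r.
Qed.

Lemma mul_deltaE X i j k l : (X * delta_mx i j) k l = X k i * (l == j)%:R.
Proof.
rewrite mxE (bigD1 i) //= big1 => [|h /negPf hi]; rewrite mxE.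
  by rewrite eqxx addr0.
by rewrite hi mulr0.
Qed.

Lemma delta_mul_sum X i j :
  delta_mx i j * X = \sum_k X j k *: (delta_mx i k : 'M[R]_n.+1).
Proof.
apply/matrixP => h l; rewrite delta_mulE summxE (bigD1 l) //= !mxE eqxx andbT.
rewrite mulrC big1 ?addr0 // => k /negPf kl.
by rewrite !mxE [l == k]eq_sym kl andbF mulr0.
Qed.

Lemma mul_delta_sum X i j :
  X * delta_mx i j = \sum_k X k i *: (delta_mx k j : 'M[R]_n.+1).
Proof.
apply/matrixP => h l; rewrite mul_deltaE summxE (bigD1 h) //= !mxE eqxx.
rewrite big1 ?addr0 // => k /negPf kh.
by rewrite !mxE [h == k]eq_sym kh mulr0.
Qed.

Lemma delta_mul_delta_sum (k : 'I_n.+1) :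
  \sum_i delta_mx i k * delta_mx k i = 1 :> 'M[R]_n.+1.
Proof.
apply/matrixP => i j; rewrite summxE (bigD1 i) //= big1 => [|h /negPf hi].
  by rewrite addr0 delta_mulE !mxE !eqxx mul1r [j == i]eq_sym.
by rewrite delta_mulE [i == h]eq_sym hi mul0r.
Qed.

Lemma central_mx_scalar Z : (forall X, X * Z = Z * X) -> Z = (Z ord0 ord0)%:M.
Proof.
move=> ZC; apply/matrixP => i j.
have := congr1 (fun M : 'M_n.+1 => M i ord0) (ZC (delta_mx j ord0)).
by rewrite delta_mulE mul_deltaE eqxx mulr1 => <-; rewrite mxE mulr_natl.
Qed.

End DeltaProducts.

Section EquivariantProjection.
Variables (R : comNzRingType) (D : derivation R).
Variables (A : algType R) (DA : derivation A).
Hypothesis hA : azumaya A.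
Variables (n : nat) (rho : {lrmorphism A -> 'M[R]_n.+1}).
Hypotheses (rho_inj : injective rho)
  (rhoD : forall a, rho (DA a) = map_mx D (rho a)).

Lemma centralising_map_der (e : 'M[R]_n.+1) :
  centralising rho e -> centralising rho (map_mx D e).
Proof.
move=> eC a; have := congr1 (map_mx D) (eC a).
by rewrite !map_derM -!rhoD (eC (DA a)) [RHS]addrC => /addrI.
Qed.

(* Write the flip tensor [\sum_(i, j) e_ij (x) e_ji] of M_n(R) = A (x) C, with C
   the centraliser of A, as [\sum_k a_k c_k (x) a'_k c'_k], and map [m] to
   [\sum_k c_k m a_k e_00 a'_k c'_k]. The flip tensor being constant, this commutes
   with the derivations; it is a projection onto A because [\tr e_00 = 1]. *)
Lemma equivariant_projection : exists p : {linear 'M[R]_n.+1 -> A},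
  cancel rho p /\ forall m, p (map_mx D m) = DA (p m).
Proof.
have [N [x [f [u [xf uf uC uK]]]]] := azumaya_coordinates rho hA.
pose pk k (m : 'M[R]_n.+1) := act_sandwich rho (u k) m.
pose d i j : 'M[R]_n.+1 := delta_mx i j.
(* By [uK], e_i0 is the sum of the products [pk k e_i0 * rho (x k)], whose factors commute; [m] is
   inserted between them. *)
pose p m := \sum_i \sum_k pk k (d i ord0) * m * rho (x k) * d ord0 i.
have pL : linear p.
  move=> c m m'; rewrite /p scaler_sumr -big_split; apply: eq_bigr => i _.
  rewrite scaler_sumr -big_split; apply: eq_bigr => k _ /=.
  by rewrite mulrDr !mulrDl -scalerAr -!scalerAl.
have p_id a : p (rho a) = rho a.
  rewrite -[RHS]mulr1 -(delta_mul_delta_sum R ord0) mulr_sumr.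
  apply: eq_bigr => i _; rewrite [delta_mx i ord0]uK mulr_suml mulr_sumr.
  apply: eq_bigr => k _; rewrite !mulrA -!/(pk k _).
  rewrite -(uC k _ a) -[in LHS]mulrA -[in LHS]mulrA (mulrA (pk k _)).
  by rewrite -(uC k _ (x k)) !mulrA.
(* Moved inside [pk], b turns e_i0 into the sum of the b_ji e_j0; the same coefficients arise from
   e_0j b on the right. *)
have p_cent m b : centralising rho b -> b * p m = p m * b.
  move=> bC; rewrite /p mulr_sumr mulr_suml.
  transitivity (\sum_i \sum_j \sum_k
    (b j i *: pk k (d j ord0)) * m * rho (x k) * d ord0 i).
    apply: eq_bigr => i _; rewrite mulr_sumr exchange_big; apply: eq_bigr => k _.
    rewrite !mulrA -act_sandwich_centl // (mul_delta_sum b) linear_sum !mulr_suml.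
    by apply: eq_bigr => j _; rewrite linearZ.
  rewrite exchange_big; apply: eq_bigr => j _; rewrite mulr_suml exchange_big.
  apply: eq_bigr => k _; rewrite -!mulrA (delta_mul_sum b) !mulr_sumr.
  by apply: eq_bigr => i _; rewrite -!scalerAl -!scalerAr !mulrA.
(* Each coordinate [pk k m] commutes with the image of A and with its centraliser, which generate
   all matrices, so it is scalar. *)
have double_centraliser m : (forall b, centralising rho b -> b * m = m * b) ->
    exists a, rho a = m.
  move=> mC; exists (\sum_k (pk k m) ord0 ord0 *: x k).
  rewrite [RHS]uK linear_sum; apply: eq_bigr => k _; rewrite linearZ /=.
  have -> : act_sandwich rho (u k) m = (pk k m ord0 ord0)%:M.
    apply: central_mx_scalar => X; rewrite [X]uK mulr_suml mulr_sumr.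
    apply: eq_bigr => l _; rewrite mulrA -uC -!mulrA; congr (_ * _).
    by rewrite -act_sandwich_centl ?mC ?act_sandwich_centr.
  by rewrite -mulmxE mul_mx_scalar.
have /choice [q qP] m : exists a, rho a = p m.
  by apply: double_centraliser => b bC; exact: p_cent.
have qL : linear q.
  by move=> c m m'; apply: rho_inj; rewrite linearP /= !qP pL.
pose Q : {linear 'M[R]_n.+1 -> A} := HB.pack q (GRing.isLinear.Build _ _ _ _ _ qL).
exists Q; split=> [a|m]; first by apply: rho_inj; rewrite /= qP p_id.
apply: rho_inj; rewrite rhoD /= !qP.
(* The tensor formed by the [pk k e] and [x k] is differentiated into the one attached to D e,
   though the dual basis itself need not be constant. For the constant e_i0 the result is 0. *)
have leib e m' : \sum_k (map_mx D (pk k e) * m' * rho (x k) +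
      pk k e * m' * rho (DA (x k))) = \sum_k pk k (map_mx D e) * m' * rho (x k).
  have De k : pk k (map_mx D e) = \sum_i (f k (DA (x i)) *: pk i e +
      f k (x i) *: map_mx D (pk i e)).
    rewrite /pk {1}(uK e) map_der_sum linear_sum; apply: eq_bigr => i _ /=.
    rewrite map_derM -rhoD linearD /= !uf //; exact/centralising_map_der/uC.
  under [RHS]eq_bigr do rewrite De !mulr_suml.
  rewrite exchange_big; apply: eq_bigr => i _ /=.
  under eq_bigr do rewrite !mulrDl -!scalerAl !scalerAr.
  have rho_x z : rho z = \sum_k f k z *: rho (x k).
    by rewrite {1}[z]xf linear_sum; apply: eq_bigr => k _; rewrite linearZ.
  by rewrite big_split /= addrC -!mulr_sumr -!rho_x.
rewrite /p map_der_sum; apply: eq_bigr => i _; rewrite map_der_sum.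
have := leib (d i ord0) m; rewrite map_der_delta.
under [RHS]eq_bigr do rewrite /pk linear0 !mul0r.
rewrite big1_eq => L0.
under [RHS]eq_bigr do rewrite !map_derM map_der_delta mulr0 addr0 -rhoD !mulrDl.
set L := \sum_k _ in L0.
transitivity (\sum_k pk k (d i ord0) * map_mx D m * rho (x k) * d ord0 i +
              L * d ord0 i).
  by rewrite L0 mul0r addr0.
rewrite /L mulr_suml -big_split; apply: eq_bigr => k _ /=.
by rewrite mulrDl addrA [X in X + _]addrC.
Qed.

(** The projection makes A a differential summand of the matrix algebra; the dual basis consists of
    the projected matrix units and the entries of [rho]. *)
Lemma constant_dual_basis_of_rep : constant_dual_basis D DA.
Proof.
have [p [pK pD]] := equivariant_projection.
pose c (k : 'I_#|{: 'I_n.+1 * 'I_n.+1}|) := enum_val k.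
pose y k := p (delta_mx (c k).1 (c k).2).
have sc k : scalar (fun a => rho a (c k).1 (c k).2).
  by move=> r a b; rewrite linearP !mxE.
pose psi k : {scalar A} := HB.pack (fun a => rho a (c k).1 (c k).2)
  (GRing.isLinear.Build _ _ _ _ _ (sc k)).
exists _, y, psi; split=> [k|k a|a].
- by rewrite /y -pD map_der_delta linear0.
- by rewrite /= rhoD mxE.
- rewrite -[LHS]pK {1}[rho a]matrix_sum_delta pair_bigA linear_sum /=.
  rewrite (reindex _ (onW_bij _ (enum_val_bij _))) /=.
  by apply: eq_bigr => k _; rewrite linearZ.
Qed.

End EquivariantProjection.

(** * The matrix representation given by a constant basis *)

Section RepresentationFromModule.
Variables (R : comNzRingType) (D : derivation R).
Variables (A : algType R) (DA : derivation A).
Hypothesis hDA : extends_derivation D DA.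
Variables (P : lmodType A) (DP : {additive P -> P}).
Hypotheses (DP_der : differential_module DA DP) (P_faithful : faithful P).
Variables (n : nat) (b : 'I_n.+1 -> restrict P).
Hypotheses (b_basis : is_basis b) (b_const : forall i, DP (b i) = 0).

(** Since b_j is constant, DA(a) b_j = DP(a b_j), and DP differentiates coordinates in the constant
    basis. *)
Lemma module_representation : exists rho : {lrmorphism A -> 'M[R]_n.+1},
  injective rho /\ forall a, rho (DA a) = map_mx D (rho a).
Proof.
have /choice [co coP] := b_basis.
have coK x : x = \sum_i co x i *: b i by case: (coP x).
have coE x (c : 'I_n.+1 -> R) : x = \sum_i c i *: b i -> forall i, co x i = c i.
  move=> xc i; have [_ /(_ [ffun i => c i])->] := coP x; first by rewrite ffunE.
  by rewrite xc; apply: eq_bigr => j _; rewrite ffunE.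
have coL c x z i : co (c *: x + z) i = c * co x i + co z i.
  rewrite (coE _ (fun i => c * co x i + co z i)) //.
  rewrite {1}(coK x) {1}(coK z) scaler_sumr -big_split; apply: eq_bigr => j _.
  by rewrite /= scalerDl scalerA.
have coD x z i : co (x + z) i = co x i + co z i.
  by rewrite -[x in LHS]scale1r coL mul1r.
have co0 i : co 0 i = 0 by apply: (@addrI _ (co 0 i)); rewrite -coD !addr0.
have coZ c x i : co (c *: x) i = c * co x i.
  by rewrite -[c *: x]addr0 coL co0 addr0.
have restrictZ (c : R) (x : P) : c *: (x : restrict P) = (c%:A : A) *: x by [].
have actZ (a : A) (c : R) (x : restrict P) :
    (a *: (c *: x : restrict P) : P) = c *: (a *: (x : P) : restrict P).
  by rewrite !restrictZ !scalerA mulr_algl mulr_algr.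
have act_sum (a : A) (x : P) : (a *: x : restrict P) =
    \sum_i co x i *: (a *: (b i : P) : restrict P).
  rewrite {1}(coK x) -[LHS]/(a *: (\sum_i (co x i *: b i : P)) : P).
  by rewrite scaler_sumr; apply: eq_bigr => i _; exact: actZ.
pose rf a : 'M[R]_n.+1 := \matrix_(i, j) co (a *: (b j : P)) i.
have rL : linear rf.
  move=> c a a'; apply/matrixP => i j; rewrite !mxE -coL; congr (co _ i).
  by rewrite scalerDl restrictZ scalerA mulr_algl.
have rM : monoid_morphism rf.
  split=> [|a a']; apply/matrixP => i j; rewrite !mxE.
    rewrite scale1r (coE _ (fun k => (k == j)%:R)) //.
    rewrite (bigD1 j) //= eqxx scale1r big1 ?addr0 // => k /negPf ->.
    by rewrite scale0r.
  rewrite -scalerA act_sum.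
  rewrite (big_morph (fun x => co x i) (fun x z => coD x z i) (co0 i)).
  by apply: eq_bigr => k _; rewrite coZ !mxE mulrC.
pose rho : {lrmorphism A -> 'M[R]_n.+1} := HB.pack rf
  (GRing.isLinear.Build _ _ _ _ rf rL) (GRing.isMonoidMorphism.Build _ _ rf rM).
exists rho; split=> [a a' /= aa'|a].
  apply/eqP; rewrite -subr_eq0; apply/eqP; apply: P_faithful => x.
  rewrite [LHS]act_sum big1 // => j _; rewrite scalerBl.
  suff -> : a *: (b j : P) = a' *: (b j : P) by rewrite subrr scaler0.
  rewrite [LHS]coK [RHS]coK; apply: eq_bigr => i _.
  by have := congr1 (fun M : 'M_n.+1 => M i j) aa'; rewrite !mxE => ->.
apply/matrixP => i j; rewrite !mxE.
apply: (coE _ (fun k => D (co (a *: (b j : P)) k))) => {i}.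
have := DP_der a (b j); rewrite b_const scaler0 addr0 => <-.
rewrite {1}(coK (a *: (b j : P))) -[LHS]/(DP (\sum_i (co _ i *: b i : P))).
rewrite raddf_sum; apply: eq_bigr => i _.
by rewrite restrictZ DP_der b_const scaler0 addr0 hDA.
Qed.

End RepresentationFromModule.

Lemma faithful_basis_gt0 (R : comNzRingType) (A : algType R) (P : lmodType A)
    (n : nat) (b : 'I_n -> restrict P) : faithful P -> is_basis b -> (0 < n)%N.
Proof.
move=> P_faithful b_basis.
rewrite lt0n; apply/negP => /eqP n0; have /eqP := oner_neq0 A; apply.
apply: P_faithful => x; rewrite scale1r; have [c [-> _]] := b_basis x.
by rewrite big1 // => -[i lti]; exfalso; rewrite n0 in lti.
Qed.

(** * Descent to the algebra of constants *)

Section ConstantRing.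
Variables (A : nzRingType) (DA : derivation A).

Definition alg_constant : {pred A} := fun a => DA a == 0.

Fact alg_constant_subring : subring_closed alg_constant.
Proof.
split=> [|a b|a b]; rewrite !unfold_in.
- by rewrite der1.
- by move=> /eqP Da /eqP Db; rewrite derD derN Da Db subr0.
- by move=> /eqP Da /eqP Db; rewrite derM Da Db mul0r mulr0 addr0.
Qed.

HB.instance Definition _ := GRing.isSubringClosed.Build A alg_constant
  alg_constant_subring.

Record constant_ring := ConstantRing { crval : A; _ : crval \in alg_constant }.

HB.instance Definition _ := [isSub for crval].
HB.instance Definition _ := [Choice of constant_ring by <:].
HB.instance Definition _ := [SubChoice_isSubNzRing of constant_ring by <:].

End ConstantRing.

(** The type carries [hDA] because scaling by R^D preserves constants only thanks to it. *)
Definition constant_alg (R : comNzRingType) (D : derivation R) (A : algType R)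
  (DA : derivation A) (hDA : extends_derivation D DA) : Type := constant_ring DA.

Section ConstantAlgebra.
Variables (R : comNzRingType) (D : derivation R).
Variables (A : algType R) (DA : derivation A).
Hypothesis hDA : extends_derivation D DA.
Local Notation A0 := (constant_alg hDA).
Local Notation S := (constants D).

HB.instance Definition _ := GRing.NzRing.on A0.

Definition calg_val (a : A0) : A := crval a.
Arguments calg_val : simpl never.

Fact calg_val_zmod : zmod_morphism calg_val.
Proof. by []. Qed.
Fact calg_val_monoid : monoid_morphism calg_val.
Proof. by []. Qed.
HB.instance Definition _ := GRing.isZmodMorphism.Build A0 A calg_val calg_val_zmod.
HB.instance Definition _ :=
  GRing.isMonoidMorphism.Build A0 A calg_val calg_val_monoid.

Lemma calg_val_inj : injective calg_val. Proof. exact: val_inj. Qed.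

Lemma der_calg_val a : DA (calg_val a) = 0.
Proof. by case: a => a aD; apply/eqP. Qed.

Lemma calg_valP a : DA a = 0 -> exists a0, calg_val a0 = a.
Proof.
move=> /eqP Da; have aD : a \in alg_constant DA by [].
by exists (ConstantRing aD).
Qed.

Fact calg_scale_subproof (s : S) (a : A0) :
  embed s *: calg_val a \in alg_constant DA.
Proof.
apply/eqP; rewrite (extends_derivationZ hDA) der_embed der_calg_val.
by rewrite scale0r scaler0 addr0.
Qed.

Definition calg_scale (s : S) (a : A0) : A0 :=
  ConstantRing (calg_scale_subproof s a).

Fact calg_scaleA s t a : calg_scale s (calg_scale t a) = calg_scale (s * t) a.
Proof. by apply: calg_val_inj; rewrite /calg_val /= scalerA. Qed.

Fact calg_scale1 : left_id 1 calg_scale.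
Proof. by move=> a; apply: calg_val_inj; exact: scale1r. Qed.

Fact calg_scaleDr : right_distributive calg_scale +%R.
Proof. by move=> s a b; apply: calg_val_inj; exact: scalerDr. Qed.

Fact calg_scaleDl a : {morph calg_scale^~ a : s t / s + t}.
Proof. by move=> s t; apply: calg_val_inj; exact: scalerDl. Qed.

HB.instance Definition _ := GRing.Zmodule_isLmodule.Build S A0
  calg_scaleA calg_scale1 calg_scaleDr calg_scaleDl.

Lemma calg_valZ (s : S) (a : A0) : calg_val (s *: a) = embed s *: calg_val a.
Proof. by []. Qed.

Fact calg_scaleAl (s : S) (a b : A0) : s *: (a * b) = s *: a * b.
Proof. by apply: calg_val_inj; rewrite rmorphM !calg_valZ rmorphM scalerAl. Qed.

HB.instance Definition _ := GRing.Lmodule_isLalgebra.Build S A0 calg_scaleAl.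

Fact calg_scaleAr (s : S) (a b : A0) : s *: (a * b) = a * (s *: b).
Proof. by apply: calg_val_inj; rewrite rmorphM !calg_valZ rmorphM scalerAr. Qed.

HB.instance Definition _ := GRing.Lalgebra_isAlgebra.Build S A0 calg_scaleAr.

End ConstantAlgebra.

Arguments calg_val : simpl never.

Section TensorSum.
Variables (S : comPzRingType) (M N : lmodType S).

Lemma tensor_suml (I : Type) (r : seq I) (F : I -> M) (b : N) :
  tensor (\sum_(i <- r) F i) b = \sum_(i <- r) tensor (F i) b.
Proof.
apply: (big_morph (fun x => tensor x b)) => [u v|]; first exact: tensorDl.
by apply: (@addrI _ (tensor 0 b)); rewrite -tensorDl !addr0.
Qed.

Lemma tensor_sumr (I : Type) (r : seq I) (F : I -> N) (a : M) :
  tensor a (\sum_(i <- r) F i) = \sum_(i <- r) tensor a (F i).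
Proof.
apply: (big_morph (tensor a)) => [u v|]; first exact: tensorDr.
by apply: (@addrI _ (tensor a 0)); rewrite -tensorDr !addr0.
Qed.

End TensorSum.

Section DualBasisDescent.
Variables (R : comNzRingType) (D : derivation R).
Variables (A : algType R) (DA : derivation A).
Hypotheses (hA : azumaya A) (hDA : extends_derivation D DA).
Variables (N : nat) (y : 'I_N -> A) (psi : 'I_N -> {scalar A}).
Hypotheses (DAy : forall i, DA (y i) = 0)
  (psiD : forall i a, psi i (DA a) = D (psi i a))
  (psiK : forall a, a = \sum_i psi i a *: y i).
Local Notation S := (constants D).
Local Notation A0 := (constant_alg hDA).
Local Notation v := (@calg_val R D A DA hDA).

(** The forms commute with the derivations, hence send constants to constants. *)
Lemma descent_dual_basis :
  exists (y0 : 'I_N -> A0) (psi0 : 'I_N -> {scalar A0}),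
    [/\ forall i, v (y0 i) = y i,
        forall i a, embed (psi0 i a) = psi i (v a)
      & forall a, a = \sum_i psi0 i a *: y0 i].
Proof.
have /choice [y0 y0P] i : exists a, v a = y i by exact: calg_valP.
have /choice [f fP] (p : 'I_N * A0) : exists s : S, embed s = psi p.1 (v p.2).
  by apply: der0_embed; rewrite -psiD der_calg_val linear0.
have fL i : scalar (fun a => f (i, a)).
  move=> s a b; apply: embed_inj.
  by rewrite rmorphD rmorphM /= !fP /= rmorphD /= calg_valZ linearP.
pose psi0 i : {scalar A0} := HB.pack (fun a => f (i, a))
  (GRing.isLinear.Build _ _ _ _ _ (fL i)).
exists y0, psi0; split=> // [i a|a]; first by rewrite /= fP.
apply: calg_val_inj; rewrite rmorph_sum {1}[v a]psiK; apply: eq_bigr => i _.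
by rewrite /= calg_valZ fP y0P.
Qed.

Lemma constant_alg_azumaya : azumaya A0.
Proof.
have [y0 [psi0 [y0P psi0P psi0K]]] := descent_dual_basis.
have [fgA0 prA0] := dual_basis_projective psi0K.
have [_ _ A_faithful surj] := hA.
split=> //.
  move=> s s0; apply: embed_inj; rewrite rmorph0; apply: A_faithful => a.
  rewrite [a]psiK scaler_sumr big1 // => i _; rewrite scalerA mulrC -scalerA.
  by rewrite -y0P -calg_valZ s0 rmorph0 scaler0.
have bal_psi i j : balanced (fun a b : A => psi i a * psi j b).
  split=> [b a a'|a b b'|r a b] /=; rewrite ?linearD ?mulrDl ?mulrDr //.
  by rewrite !linearZ /= mulrCA mulrA.
(* Coordinates of A (x) A in the tensor square of the dual basis. *)
pose cf i j (t : tens A A) : R := tens_lift (fun a b : A => psi i a * psi j b) t.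
have bal_D : balanced (fun a b : A => tensor (DA a) b + tensor a (DA b) : tens A A).
  split=> [b a a'|a b b'|r a b] /=.
  - by rewrite derD !tensorDl addrACA.
  - by rewrite derD !tensorDr addrACA.
  - rewrite !(extends_derivationZ hDA) tensorDl tensorDr !tensorZ.
    by rewrite -!addrA [X in _ = X]addrCA.
pose Dt (t : tens A A) : tens A A :=
  tens_lift (fun a b : A => tensor (DA a) b + tensor a (DA b)) t.
have cf_Dt i j t : cf i j (Dt t) = D (cf i j t).
  elim/tens_ind: t => [|a b|t u IHt IHu].
  - by rewrite /Dt /cf (tens_lift0 bal_D) (tens_lift0 (bal_psi i j)) der0.
  - rewrite /Dt (tens_liftE bal_D) /cf (tens_liftD (bal_psi i j)).
    by rewrite !(tens_liftE (bal_psi i j)) derM !psiD.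
  - rewrite /Dt (tens_liftD bal_D) /cf !(tens_liftD (bal_psi i j)) derD.
    by rewrite -IHt -IHu.
(* The derivation of A (x) A corresponds to the commutator with [DA] on endomorphisms. *)
have sandwich_Dt t x : sandwich (Dt t) x = DA (sandwich t x) - sandwich t (DA x).
  elim/tens_ind: t => [|a b|t u IHt IHu].
  - rewrite /Dt (tens_lift0 bal_D) /sandwich !(tens_lift0 (sandwich_bal _)).
    by rewrite der0 subr0.
  - rewrite /Dt (tens_liftE bal_D) sandwichD !sandwichE !derM.
    by rewrite mulrDl addrAC addrK.
  - rewrite /Dt (tens_liftD bal_D) !sandwichD -/(Dt t) -/(Dt u) IHt IHu derD.
    by rewrite opprD addrACA.
have bal_v : balanced (fun a b : A0 => tensor (v a) (v b) : tens A A).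
  split=> [b a a'|a b b'|s a b] /=; rewrite ?rmorphD ?tensorDl ?tensorDr //.
  by rewrite !calg_valZ tensorZ.
pose iota (t : tens A0 A0) : tens A A :=
  tens_lift (fun a b : A0 => tensor (v a) (v b)) t.
have sandwich_iota t x : sandwich (iota t) (v x) = v (sandwich t x).
  elim/tens_ind: t => [|a b|t u IHt IHu].
  - rewrite /iota (tens_lift0 bal_v) /sandwich !(tens_lift0 (sandwich_bal _)).
    by rewrite rmorph0.
  - by rewrite /iota (tens_liftE bal_v) !sandwichE !rmorphM.
  - by rewrite /iota (tens_liftD bal_v) !sandwichD rmorphD /= -IHt -IHu.
have iotaK t : exists c : 'I_N * 'I_N -> S,
    t = \sum_p tensor (c p *: y0 p.1) (y0 p.2) /\
    forall p, embed (c p) = cf p.1 p.2 (iota t).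
  elim/tens_ind: t => [|a b|t u [c [Et cP]] [d [Eu dP]]].
  - exists (fun=> 0); split=> [|p].
      rewrite big1 // => p _; rewrite scale0r.
      by apply: (@addrI _ (tensor 0 (y0 p.2))); rewrite -tensorDl !addr0.
    by rewrite /iota (tens_lift0 bal_v) /cf (tens_lift0 (bal_psi _ _)) rmorph0.
  - exists (fun p => psi0 p.1 a * psi0 p.2 b); split=> [|p].
      rewrite {1}[a]psi0K {1}[b]psi0K tensor_suml.
      under eq_bigr do rewrite tensor_sumr.
      rewrite pair_bigA; apply: eq_bigr => p _ /=.
      by rewrite -tensorZ scalerA mulrC.
    rewrite /iota (tens_liftE bal_v) /cf (tens_liftE (bal_psi _ _)).
    by rewrite rmorphM /= !psi0P.
  - exists (fun p => c p + d p); split=> [|p].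
      rewrite {1}Et {1}Eu -big_split; apply: eq_bigr => p _ /=.
      by rewrite scalerDl tensorDl.
    rewrite /iota (tens_liftD bal_v) /cf (tens_liftD (bal_psi _ _)).
    by rewrite rmorphD /= cP dP.
have iota_inj : injective iota.
  move=> t u tu; have [c [Et cP]] := iotaK t; have [d [Eu dP]] := iotaK u.
  rewrite {}Et {}Eu; apply: eq_bigr => p _; congr (tensor (_ *: _) _).
  by apply: embed_inj; rewrite cP tu dP.
have A_ext (g h : A -> A) : linear g -> linear h ->
    (forall x, g (v x) = h (v x)) -> g =1 h.
  move=> gL hL gh a.
  pose g' : {linear A -> A} := HB.pack g (GRing.isLinear.Build _ _ _ _ _ gL).
  pose h' : {linear A -> A} := HB.pack h (GRing.isLinear.Build _ _ _ _ _ hL).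
  rewrite -[g]/(g' : A -> A) -[h]/(h' : A -> A) [a]psiK !linear_sum.
  by apply: eq_bigr => i _; rewrite !linearZ /= -y0P gh.
move=> f.
(* The R-linear extension of [f]. It commutes with [DA], so the tensor inducing it has zero
   derivative and constant coordinates, and descends. *)
pose g a := \sum_i psi i a *: v (f (y0 i)).
have gL : linear g.
  move=> r a b; rewrite /g scaler_sumr -big_split; apply: eq_bigr => i _ /=.
  by rewrite linearP scalerDl scalerA.
pose G : {linear A -> A} := HB.pack g (GRing.isLinear.Build _ _ _ _ _ gL).
have gv x : g (v x) = v (f x).
  rewrite [in RHS](psi0K x) linear_sum rmorph_sum; apply: eq_bigr => i _.
  by rewrite linearZ /= calg_valZ psi0P.
have [t [tP _]] := surj G.
have Dt0 : Dt t = 0.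
  apply: (sandwich_inj hA) => x; rewrite sandwich_Dt !tP /= /g der_sum.
  rewrite [RHS](tens_lift0 (sandwich_bal x)) -sumrB big1 // => i _.
  rewrite (extends_derivationZ hDA) der_calg_val scaler0 addr0 psiD.
  by rewrite subrr.
have /choice [c cP] (p : 'I_N * 'I_N) : exists s : S, embed s = cf p.1 p.2 t.
  apply: der0_embed; rewrite -cf_Dt Dt0; exact: tens_lift0 (bal_psi _ _).
have tE u : u = \sum_(p : 'I_N * 'I_N) tensor (cf p.1 p.2 u *: y p.1) (y p.2).
  elim/tens_ind: u => [|a b|u w IHu IHw].
  - rewrite big1 // => p _; rewrite /cf (tens_lift0 (bal_psi _ _)) scale0r.
    by apply: (@addrI _ (tensor 0 (y p.2))); rewrite -tensorDl !addr0.
  - rewrite {1}[a]psiK {1}[b]psiK tensor_suml.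
    under eq_bigr do rewrite tensor_sumr.
    rewrite pair_bigA; apply: eq_bigr => p _ /=.
    by rewrite -tensorZ scalerA mulrC /cf (tens_liftE (bal_psi _ _)).
  - rewrite {1}IHu {1}IHw -big_split; apply: eq_bigr => p _ /=.
    by rewrite /cf (tens_liftD (bal_psi _ _)) scalerDl tensorDl.
pose t0 : tens A0 A0 := \sum_p tensor (c p *: y0 p.1) (y0 p.2).
have t0E : iota t0 = t.
  rewrite [RHS]tE /iota (big_morph _ (tens_liftD bal_v) (tens_lift0 bal_v)).
  by apply: eq_bigr => p _; rewrite (tens_liftE bal_v) calg_valZ cP !y0P.
exists t0; split=> [x|u uP].
  by apply: calg_val_inj; rewrite -sandwich_iota t0E tP -gv.
apply: iota_inj; rewrite t0E; apply: (sandwich_inj hA).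
apply: A_ext; try exact: sandwich_linear.
by move=> x; rewrite tP /= gv sandwich_iota uP.
Qed.

End DualBasisDescent.

Section DescentIsomorphism.
Variables (R : comNzRingType) (D : derivation R).
Variables (A : algType R) (DA : derivation A).
Hypothesis hDA : extends_derivation D DA.
Local Notation RD := (over_constants D).
Local Notation A0 := (constant_alg hDA).
Local Notation v := (@calg_val R D A DA hDA).
Variables (N : nat) (y : 'I_N -> A) (psi : 'I_N -> {scalar A}).
Hypotheses (DAy : forall i, DA (y i) = 0)
  (psiD : forall i a, psi i (DA a) = D (psi i a))
  (psiK : forall a, a = \sum_i psi i a *: y i).

Lemma base_change_tensorZ (B : algType (constants D)) (r : R) (x : RD) (b : B) :
  r *: (tensor x b : base_change B) = tensor ((r : RD) * x) b.
Proof. exact: base_change_scaleE. Qed.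

(** The inverse is r (x) a |-> r a. Multiplicativity is proved for it and transferred. *)
Lemma descent_isomorphism : exists phi : {lrmorphism A -> base_change A0},
  bijective phi /\ forall a, phi (DA a) = base_change_der A0 (phi a).
Proof.
have [y0 [psi0 [y0P psi0P psi0K]]] := descent_dual_basis hDA DAy psiD psiK.
have bal : balanced (fun (r : RD) (a : A0) => (r : R) *: v a).
  split=> [a r r'|r a a'|s r a] /=; rewrite ?scalerDl ?rmorphD ?scalerDr //.
  by rewrite calg_valZ scalerA mulrC.
pose back (t : base_change A0) : A :=
  tens_lift (fun (r : RD) (a : A0) => (r : R) *: v a) t.
pose fwd a : base_change A0 := \sum_i tensor (psi i a : RD) (y0 i).
have fwdL : linear fwd.
  move=> r a b; rewrite /fwd scaler_sumr -big_split; apply: eq_bigr => i _ /=.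
  by rewrite linearP tensorDl base_change_tensorZ.
pose F : {linear A -> base_change A0} :=
  HB.pack fwd (GRing.isLinear.Build _ _ _ _ fwd fwdL).
have backD t u : back (t + u) = back t + back u by exact: tens_liftD bal t u.
have back0 : back 0 = 0 by exact: tens_lift0 bal.
have backE r a : back (tensor r a) = (r : R) *: v a by exact: tens_liftE bal r a.
have fwdK : cancel fwd back.
  move=> a; rewrite /fwd (big_morph back backD back0) [RHS]psiK.
  by apply: eq_bigr => i _; rewrite backE y0P.
have backK : cancel back fwd.
  elim/tens_ind => [|r a|t u IHt IHu].
  - by rewrite back0 -[fwd]/(F : A -> _) linear0.
  (* The form psi_i takes a constant to an element of R^D, which crosses the tensor sign. *)
  - rewrite backE /fwd [in RHS](psi0K a) tensor_sumr; apply: eq_bigr => i _.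
    by rewrite linearZ /= -psi0P -tensorZ mulrC.
  - by rewrite backD -[fwd]/(F : A -> _) linearD /= IHt IHu.
have backM t u : back (t * u) = back t * back u.
  elim/tens_ind: t => [|r a|t t' IH IH'].
  - by rewrite mul0r back0 mul0r.
  - elim/tens_ind: u => [|r' a'|u u' IH IH'].
    + by rewrite mulr0 back0 mulr0.
    + rewrite [X in back X]tensorM !backE rmorphM.
      by rewrite -scalerAl -scalerAr scalerA.
    + by rewrite mulrDr !backD IH IH' mulrDr.
  - by rewrite mulrDl !backD IH IH' mulrDl.
have fwdM : monoid_morphism fwd.
  split=> [|a b]; apply: (can_inj backK); last by rewrite backM !fwdK.
  by rewrite fwdK [X in back X](_ : _ = tensor 1 1) // backE rmorph1 scale1r.
pose phi : {lrmorphism A -> base_change A0} := HB.pack fwd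
  (GRing.isLinear.Build _ _ _ _ fwd fwdL)
  (GRing.isMonoidMorphism.Build _ _ fwd fwdM).
exists phi; split=> [|a]; first by exists back.
rewrite /= /fwd [RHS](der_sum (base_change_der A0)).
by apply: eq_bigr => i _; rewrite [RHS]base_change_derE psiD.
Qed.

End DescentIsomorphism.

(** A dual basis (x_i, f_i) of A0 over R^D extends to R (x) A0 as 1 (x) x_i and r (x) b |-> r
    f_i(b). Both are constant because D acts on the factor R alone. *)
Lemma base_change_dual_basis (R : comNzRingType) (D : derivation R)
    (A : algType R) (DA : derivation A) (A0 : algType (constants D))
    (phi : {lrmorphism A -> base_change A0}) :
  azumaya A0 -> bijective phi ->
  (forall a, phi (DA a) = base_change_der A0 (phi a)) ->
  constant_dual_basis D DA.
Proof.
move=> [fgA0 prA0 _ _] [phi' phiK phiK'] phiD.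
have [N [x [f xf]]] := projective_dual_basis fgA0 prA0.
have bal i : balanced
    (fun (r : over_constants D) (b : A0) => (r : R) * embed (f i b)).
  split=> [b r r'|r b b'|s r b] /=; rewrite ?mulrDl ?linearD ?rmorphD ?mulrDr //.
  by rewrite linearZ rmorphM /= mulrA [(r : R) * _]mulrC.
pose L i (t : base_change A0) : R :=
  tens_lift (fun (r : over_constants D) (b : A0) => (r : R) * embed (f i b)) t.
have LD i t u : L i (t + u) = L i t + L i u by exact: tens_liftD (bal i) t u.
have L0 i : L i 0 = 0 by exact: tens_lift0 (bal i).
have LE i r b : L i (tensor r b) = (r : R) * embed (f i b).
  exact: tens_liftE (bal i) r b.
have LZ i (r : R) t : L i (r *: t) = r * L i t.
  elim/tens_ind: t => [|r' b|t u IHt IHu].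
  - by rewrite scaler0 L0 mulr0.
  - by rewrite base_change_tensorZ !LE mulrA.
  - by rewrite scalerDr !LD IHt IHu mulrDr.
have Lder i t : L i (base_change_der A0 t) = D (L i t).
  elim/tens_ind: t => [|r b|t u IHt IHu].
  - by rewrite der0 L0 der0.
  - by rewrite [X in L i X]base_change_derE !LE derM der_embed mulr0 addr0.
  - by rewrite derD !LD derD IHt IHu.
have LK t : t = \sum_i L i t *: (tensor 1 (x i) : base_change A0).
  elim/tens_ind: t => [|r b|t u IHt IHu].
  - by rewrite big1 // => i _; rewrite L0 scale0r.
  - rewrite {1}(xf b) tensor_sumr; apply: eq_bigr => i _.
    by rewrite base_change_tensorZ mulr1 LE -tensorZ mulrC.
  - rewrite {1}IHt {1}IHu -big_split; apply: eq_bigr => i _ /=.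
    by rewrite LD scalerDl.
have sc i : scalar (fun a => L i (phi a)).
  by move=> r a b; rewrite linearP LD LZ.
pose psi i : {scalar A} := HB.pack (fun a => L i (phi a))
  (GRing.isLinear.Build _ _ _ _ _ (sc i)).
exists N, (fun i => phi' (tensor 1 (x i))), psi; split=> [i|i a|a].
- apply: (can_inj phiK); rewrite phiD phiK' linear0 [LHS]base_change_derE der1.
  by apply: (@addrI _ (tensor 0 (x i))); rewrite -tensorDl !addr0.
- by rewrite /= phiD Lder.
- apply: (can_inj phiK); rewrite {1}[phi a]LK linear_sum.
  by apply: eq_bigr => i _; rewrite linearZ /= phiK'.
Qed.

Theorem corollary4 (R : comNzRingType) (D : derivation R)
    (A : algType R) (DA : derivation A)
    (hA : azumaya A) (hDA : extends_derivation D DA) :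
  (exists (P : lmodType A) (DP : {additive P -> P}),
      [/\ differential_module DA DP,
          faithful P,
          finitely_generated (restrict P),
          projective (restrict P)
        & exists (n : nat) (b : 'I_n -> restrict P),
            is_basis b /\ (forall i, DP (b i) = 0)])
  <->
  (exists A0 : algType (constants D),
      azumaya A0 /\
      exists phi : {lrmorphism A -> base_change A0},
        bijective phi /\
        (forall a, phi (DA a) = base_change_der A0 (phi a))).
Proof.
split.
  move=> [P [DP [DP_der P_faithful _ _ [n [b [b_basis b_const]]]]]].
  have := faithful_basis_gt0 P_faithful b_basis.
  case: n b b_basis b_const => // n b b_basis b_const _.
  have [rho [rho_inj rhoD]] :=
    module_representation hDA DP_der P_faithful b_basis b_const.
  have [N [y [psi [DAy psiD psiK]]]] := constant_dual_basis_of_rep hA rho_inj rhoD.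
  exists (constant_alg hDA); split; first exact: constant_alg_azumaya DAy psiD psiK.
  exact: descent_isomorphism DAy psiD psiK.
move=> [A0 [A0_az [phi [phi_bij phiD]]]].
have [N [y [psi [DAy psiD psiK]]]] := base_change_dual_basis A0_az phi_bij phiD.
have [_ _ A_faithful _] := hA.
exact (dual_basis_module A_faithful DAy psiD psiK).
Qed.
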